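(* Let $X$ be an NPC space and let $G$ be a totally disconnected, locally compact group acting continuously by isometries on $X$. Suppose $g \in G$ has unbounded action on $X$, with an attracting point $\xi \in \partial X$. (i) We have $s_G(g) = s_{G_{\xi}}(g)$. (ii) If $G$ acts properly on $X$ and $g$ is hyperbolic, then $s_G(g) = \Delta_{G_{\xi}}(g)$.
   Context: An NPC space is a geodesic metric space $X$ that is either (a) complete and CAT(0), or (b) proper (closed balls are compact) and $\delta$-hyperbolic for some $\delta \ge 0$ (every geodesic triangle is $\delta$-thin: each point on a side lies within distance $\delta$ of a point on another side). The boundary $\partial X$ is the set of equivalence classes of geodesic rays, where $\gamma_1\sim\gamma_2$ if $d(\gamma_1(t),\gamma_2(t))$ is bounded over $t\ge 0$; isometries act on $\partial X$, and $G_\xi$ denotes the stabilizer of $\xi$ in $G$. Convergence of sequences in $X$ to boundary points is in the usual sense (cone topology for CAT(0) spaces, Gromov boundary for proper $\delta$-hyperbolic spaces). An isometry $g$ has bounded action if the orbits of $\langle g\rangle$ on $X$ are bounded, and unbounded action otherwise. An isometry $g$ is hyperbolic if: in case (a), it has an axis, i.e. there are a geodesic line $\gamma:\mathbb{R}\to X$ and $k>0$ with $g\gamma(t)=\gamma(t+k)$ for all $t$; in case (b), $n\mapsto g^nx$ is a quasi-isometric embedding of $\mathbb{Z}$ into $X$ for some (equivalently any) $x$. A point $\xi\in\partial X$ is the attracting point of $g$ if $g^nx\to\xi$ as $n\to+\infty$ for all $x\in X$. An isometric action of $G$ on $X$ is proper if for all $x\in X$, $r>0$ the set $\{g\in G: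 d(gx,x)\le r\}$ has compact closure. For a totally disconnected, locally compact group $H$ and $g\in H$, the scale $s_H(g)$ is the minimum of $|gUg^{-1}:U\cap gUg^{-1}|$ over all compact open subgroups $U$ of $H$. The modular function is $\Delta_H(g)=\mu(gU)/\mu(U)$, where $\mu$ is a right-invariant Haar measure on $H$ and $U$ is any compact open subgroup of $H$. *)

(* Defs.v *)
From HB Require Import structures.
From mathcomp Require Import all_boot all_order all_algebra.
From mathcomp Require Import all_classical all_reals all_analysis.

Set Implicit Arguments.
Unset Strict Implicit.
Unset Printing Implicit Defensive.

Import Order.TTheory GRing.Theory Num.Theory.
Import numFieldNormedType.Exports.

Local Open Scope classical_set_scope.
Local Open Scope ring_scope.

HB.mixin Record Group_isTopGroup G of Topological G & Group G := {
  mulg_continuous : continuous (fun p : G * G => (p.1 * p.2)%g) ;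
  invg_continuous : continuous (fun x : G => (x^-1)%g)
}.

#[short(type="topGroupType")]
HB.structure Definition TopGroup :=
  {G of Topological G & Group G & Group_isTopGroup G}.

Definition tdlc (G : topGroupType) : Prop :=
  [/\ hausdorff_space G, locally_compact [set: G]
    & totally_disconnected [set: G]].

Definition is_subgroup (G : groupType) (U : set G) : Prop :=
  [/\ U 1%g, forall x y, U x -> U y -> U (x * y)%g
    & forall x, U x -> U (x^-1)%g].

Record subgroup (G : groupType) := Subgroup {
  subgroup_set : set G ;
  subgroupP : is_subgroup subgroup_set
}.

Definition subgroup_type (G : groupType) (H : subgroup G) : Type :=
  set_type (subgroup_set H).

Section SubgroupType.
Variables (G : groupType) (H : subgroup G).

HB.instance Definition _ := SubChoice.on (subgroup_type H).

Lemma subgroup_group_closed : group_closed (mem (subgroup_set H)).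
Proof.
have [H1 HM HV] := subgroupP H; split; first by rewrite inE.
by move=> x y /set_mem Hx /set_mem Hy; apply/mem_set/HM => //; exact: HV.
Qed.

HB.instance Definition _ :=
  SubChoice_isSubGroup.Build G (mem (subgroup_set H)) (subgroup_type H)
    subgroup_group_closed.

End SubgroupType.

Section SubgroupTopology.
Variables (G : topGroupType) (H : subgroup G).

HB.instance Definition _ :=
  Topological.copy (subgroup_type H) (set_type (subgroup_set H)).

Lemma subgroup_val_continuous : continuous (fun x : subgroup_type H => val x).
Proof. exact: initial_continuous. Qed.

Lemma subgroup_continuousP (T : topologicalType) (f : T -> subgroup_type H) :
  continuous (fun t => val (f t)) -> continuous f.
Proof.
move=> /continuousP cf; apply/continuousP => _ [B oB <-].
exact: (cf B oB).
Qed.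

Lemma subgroup_mulg_continuous :
  continuous (fun p : subgroup_type H * subgroup_type H => (p.1 * p.2)%g).
Proof.
apply: subgroup_continuousP => p.
apply: (@continuous_comp _ _ _
  (fun p : subgroup_type H * subgroup_type H => (val p.1, val p.2))
  (fun q : G * G => (q.1 * q.2)%g)); last exact: mulg_continuous.
apply: cvg_pair => /=.
  by apply: continuous_comp; [exact: cvg_fst|exact: subgroup_val_continuous].
by apply: continuous_comp; [exact: cvg_snd|exact: subgroup_val_continuous].
Qed.

Lemma subgroup_invg_continuous :
  continuous (fun x : subgroup_type H => (x^-1)%g).
Proof.
apply: subgroup_continuousP => x.
apply: (@continuous_comp _ _ _ (fun x : subgroup_type H => val x)
  (fun y : G => (y^-1)%g)); last exact: invg_continuous.
exact: subgroup_val_continuous.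
Qed.

HB.instance Definition _ := Group_isTopGroup.Build (subgroup_type H)
  subgroup_mulg_continuous subgroup_invg_continuous.

End SubgroupTopology.

Section Scale.
Variable H : topGroupType.
Implicit Types (U V : set H) (g : H).

Definition compact_open_subgroup U : Prop :=
  [/\ is_subgroup U, compact U & open U].

Definition left_translate g U : set H := [set (g * u)%g | u in U].

Definition conj_set g U : set H := [set (g * u * g^-1)%g | u in U].

Definition left_cosets U V : set (set H) := [set left_translate u V | u in U].

Definition has_index U V (n : nat) : Prop := (left_cosets U V #= `I_n)%card.

Definition scale_values g : set nat :=
  [set n | exists2 U, compact_open_subgroup U &
             has_index (conj_set g U) (U `&` conj_set g U) n].

(* [scale_values g] is nonempty when [H] is tdlc (van Dantzig); the default
   value 0 of [xget] is then never used. *)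
Definition scale g : nat :=
  xget 0%N [set n | scale_values g n /\
                    forall m, scale_values g m -> (n <= m)%N].

End Scale.

(* Measurable types are pointed in the library: the point is 1. *)
Definition pointed_group (H : topGroupType) : Type := H.
HB.instance Definition _ (H : topGroupType) := TopGroup.on (pointed_group H).
HB.instance Definition _ (H : topGroupType) :=
  isPointed.Build (pointed_group H) (1%g : H).

Definition borel (H : topGroupType) :=
  g_sigma_algebraType (@open (pointed_group H)).

Record right_haar (R : realType) (H : topGroupType)
    (mu : {measure set (borel H) -> \bar R}) : Prop := {
  haar_neq0 : mu setT != 0%E ;
  haar_right_invariant : forall (h : H) (A : set (borel H)), measurable A ->
    mu [set (a * h)%g | a in (A : set H)] = mu A ;
  haar_compact : forall K : set H, compact K -> (mu K < +oo)%E ;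
  haar_outer_regular : forall A : set (borel H), measurable A ->
    mu A = ereal_inf [set mu O | O in
             [set O : set H | open O /\ (A : set H) `<=` O]] ;
  haar_inner_regular : forall O : set H, open O ->
    mu O = ereal_sup [set mu K | K in
             [set K : set H | compact K /\ K `<=` O]]
}.

(* [mu (g U) / mu U]; for a right Haar measure [mu] and a compact open subgroup
   [U], both measures are finite and nonzero, and the ratio does not depend on
   [mu] or [U]. *)
Definition modular (R : realType) (H : topGroupType)
    (mu : {measure set (borel H) -> \bar R}) (U : set H) (g : H) : R :=
  fine (mu (left_translate g U)) / fine (mu U).

Section Metric.
Variables (R : realType) (X : metricType R).
Implicit Types (x y z p q r : X).

Definition geodesic x y (sigma : R -> X) : Prop :=
  [/\ sigma 0 = x, sigma (mdist x y) = y
    & forall s t, 0 <= s <= mdist x y -> 0 <= t <= mdist x y ->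
        mdist (sigma s) (sigma t) = `|s - t|].

Definition geodesic_space : Prop := forall x y, exists sigma, geodesic x y sigma.

Definition complete_space : Prop :=
  forall F : set_system X, ProperFilter F -> cauchy F -> exists x, F --> x.

Definition proper_space : Prop :=
  forall x (r : R), compact [set y | mdist x y <= r].

Definition eucl_dist (a b : R * R) : R :=
  Num.sqrt ((a.1 - b.1) ^+ 2 + (a.2 - b.2) ^+ 2).

(* [x'] is the comparison point on the segment [p', q'] of [x] in [p, q]. *)
Definition comparison_point p q x (p' q' x' : R * R) : Prop :=
  eucl_dist p' x' = mdist p x /\ eucl_dist x' q' = mdist x q.

(* Two points on the same or on two different sides of a geodesic triangle
   always lie on two sides issued from a common vertex, here [p]; the third
   side plays no role in the comparison inequality for these points. *)
Definition CAT0 : Prop :=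
  forall p q r (sigma tau : R -> X),
    geodesic p q sigma -> geodesic p r tau ->
  forall p' q' r' : R * R,
    eucl_dist p' q' = mdist p q -> eucl_dist p' r' = mdist p r ->
    eucl_dist q' r' = mdist q r ->
  forall s t, 0 <= s <= mdist p q -> 0 <= t <= mdist p r ->
  forall x' y' : R * R,
    comparison_point p q (sigma s) p' q' x' ->
    comparison_point p r (tau t) p' r' y' ->
    mdist (sigma s) (tau t) <= eucl_dist x' y'.

(* Every side of a triangle is the side [p, q] of some relabelling of it. *)
Definition thin_triangles (delta : R) : Prop :=
  forall p q r (sigma tau rho : R -> X),
    geodesic p q sigma -> geodesic q r tau -> geodesic p r rho ->
  forall s, 0 <= s <= mdist p q ->
    (exists2 t, 0 <= t <= mdist q r & mdist (sigma s) (tau t) <= delta) \/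
    (exists2 t, 0 <= t <= mdist p r & mdist (sigma s) (rho t) <= delta).

End Metric.

(* A space can be NPC for both reasons; convergence to the boundary and
   hyperbolicity of isometries are read according to the chosen one. *)
Inductive npc_case := CompleteCAT0 | ProperHyperbolic.

Definition npc_space (R : realType) (c : npc_case) (X : metricType R) : Prop :=
  geodesic_space X /\
  match c with
  | CompleteCAT0 => complete_space X /\ CAT0 X
  | ProperHyperbolic =>
      proper_space X /\ exists2 delta : R, 0 <= delta & thin_triangles X delta
  end.

Section Boundary.
Variables (R : realType) (X : metricType R).
Implicit Types (gamma : R -> X).

(* Only the restriction of [gamma] to the nonnegative reals matters. *)
Definition geodesic_ray gamma : Prop :=
  forall s t, 0 <= s -> 0 <= t -> mdist (gamma s) (gamma t) = `|s - t|.

Definition asymptotic gamma1 gamma2 : Prop :=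
  exists C : R, forall t, 0 <= t -> mdist (gamma1 t) (gamma2 t) <= C.

Definition ray_class gamma : set (R -> X) :=
  [set gamma' | geodesic_ray gamma' /\ asymptotic gamma gamma'].

Record boundary := Boundary {
  boundary_class : set (R -> X) ;
  boundaryP : exists2 gamma, geodesic_ray gamma &
                boundary_class = ray_class gamma
}.

Lemma boundary_inj xi eta : boundary_class xi = boundary_class eta -> xi = eta.
Proof.
case: xi eta => [A PA] [B PB] /= AB; rewrite -AB in PB *.
by congr Boundary; exact: Prop_irrelevance.
Qed.

(* Basic neighbourhoods of the cone topology, intersected with [X]: the points
   beyond distance [r] of [gamma 0] whose projection to the closed ball of
   radius [r] about [gamma 0] is within [e] of [gamma r]. *)
Definition cone_nbhd gamma (r e : R) : set X :=
  [set y | r < mdist (gamma 0) y /\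
     forall sigma, geodesic (gamma 0) y sigma -> mdist (sigma r) (gamma r) < e].

Definition cone_cvg (u : nat -> X) (xi : boundary) : Prop :=
  forall gamma, boundary_class xi gamma ->
  forall r e : R, 0 < r -> 0 < e ->
    \forall n \near \oo, cone_nbhd gamma r e (u n).

Definition gromov_product (p x y : X) : R :=
  (mdist p x + mdist p y - mdist x y) / 2.

(* [u] converges to infinity and is equivalent to [gamma 0, gamma 1, ...]. *)
Definition gromov_cvg (u : nat -> X) (xi : boundary) : Prop :=
  forall gamma, boundary_class xi gamma -> forall (p : X) (K : R),
  exists N : nat, forall i j : nat, (N <= i)%N -> (N <= j)%N ->
    K <= gromov_product p (u i) (gamma j%:R).

Definition cvg_boundary (c : npc_case) :=
  match c with
  | CompleteCAT0 => cone_cvg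
  | ProperHyperbolic => gromov_cvg
  end.

End Boundary.

Record isom_action (R : realType) (G : topGroupType) (X : metricType R) :=
  IsomAction {
  act :> G -> X -> X ;
  act1 : forall x, act 1%g x = x ;
  actM : forall g h x, act (g * h)%g x = act g (act h x) ;
  act_isom : forall g x y, mdist (act g x) (act g y) = mdist x y ;
  act_continuous : continuous (fun p : G * X => act p.1 p.2)
}.

Definition zpow (G : groupType) (g : G) (n : int) : G :=
  match n with
  | Posz k => (g ^+ k)%g
  | Negz k => ((g ^+ k.+1)^-1)%g
  end.

Section Action.
Variables (R : realType) (G : topGroupType) (X : metricType R).
Variable a : isom_action G X.
Implicit Types (g h : G) (xi : boundary X).

Definition bounded_action g : Prop :=
  forall x, exists C : R, forall m n : int,
    mdist (a (zpow g m) x) (a (zpow g n) x) <= C.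

Definition act_rays g (A : set (R -> X)) : set (R -> X) :=
  [set a g \o gamma | gamma in A].

Lemma act_rays1 A : act_rays 1%g A = A.
Proof.
have E (gamma : R -> X) : a 1%g \o gamma = gamma.
  by apply/funext => t /=; rewrite act1.
rewrite /act_rays; apply/seteqP; split => gamma /=.
  by move=> [gamma' Agamma <-]; rewrite E.
by move=> Agamma; exists gamma.
Qed.

Lemma act_raysM g h A : act_rays (g * h)%g A = act_rays g (act_rays h A).
Proof.
have E (gamma : R -> X) : a (g * h)%g \o gamma = a g \o (a h \o gamma).
  by apply/funext => t /=; rewrite actM.
apply/seteqP; split => [_ [gamma Agamma <-]|_ [_ [gamma Agamma <-] <-]].
  by exists (a h \o gamma); [exists gamma|rewrite E].
by exists gamma.
Qed.

Lemma act_rays_boundary g xi : exists2 gamma, geodesic_ray gamma &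
  act_rays g (boundary_class xi) = ray_class gamma.
Proof.
have ray h (gamma : R -> X) : geodesic_ray gamma -> geodesic_ray (a h \o gamma).
  by move=> rg s t s0 t0 /=; rewrite act_isom; exact: rg.
have [gamma rgamma ->] := boundaryP xi.
exists (a g \o gamma); first exact: ray.
apply/seteqP; split => [_ [gamma' [rgamma' [C gC]] <-]|gamma' [rgamma' [C gC]]].
  split; first exact: ray.
  by exists C => t t0 /=; rewrite act_isom; exact: gC.
exists (a (g^-1)%g \o gamma').
  split; first exact: ray.
  exists C => t t0 /=; rewrite -(act_isom a g) -actM mulgV act1.
  exact: gC.
by apply/funext => t /=; rewrite -actM mulgV act1.
Qed.

Definition act_boundary g xi : boundary X :=
  Boundary (act_rays_boundary g xi).

Lemma stabilizer_is_subgroup xi :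
  is_subgroup [set g : G | act_boundary g xi = xi].
Proof.
have E g : act_boundary g xi = xi <->
    act_rays g (boundary_class xi) = boundary_class xi.
  split=> [/(congr1 (@boundary_class R X))//|gxi].
  exact: boundary_inj.
split=> [|g h /E gxi /E hxi|g /E gxi]; apply/E.
- exact: act_rays1.
- by rewrite act_raysM hxi.
- by rewrite -[in LHS]gxi -act_raysM mulVg act_rays1.
Qed.

Definition stabilizer xi : subgroup G := Subgroup (stabilizer_is_subgroup xi).

Definition attracting (c : npc_case) g xi : Prop :=
  forall x, cvg_boundary c (fun n => a (g ^+ n)%g x) xi.

Definition has_axis g : Prop :=
  exists2 gamma : R -> X,
    (forall s t, mdist (gamma s) (gamma t) = `|s - t|) &
    exists2 k : R, 0 < k & forall t, a g (gamma t) = gamma (t + k).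

Definition quasi_isometric_orbit g : Prop :=
  exists (x : X) (L C : R), [/\ 1 <= L, 0 <= C &
    forall m n : int,
      L^-1 * `|m - n|%:~R - C <= mdist (a (zpow g m) x) (a (zpow g n) x)
        <= L * `|m - n|%:~R + C].

Definition hyperbolic (c : npc_case) g : Prop :=
  match c with
  | CompleteCAT0 => has_axis g
  | ProperHyperbolic => quasi_isometric_orbit g
  end.

Definition proper_action : Prop :=
  forall (x : X) (r : R), 0 < r ->
    compact (closure [set g : G | mdist (a g x) x <= r]).

End Action.

(* Main.v *)
Require Import Defs.
From mathcomp Require Import all_boot all_order all_algebra.
From mathcomp Require Import all_classical all_reals all_analysis.
From mathcomp Require Import ring lra.

(** Write [f] for conjugation by [g], [H] for the stabilizer of [xi], and, for a
    compact open subgroup [U] of [G], [U_+] and [U_-] for the intersections of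
    the [f^n(U)], respectively of the [f^-n(U)], over [n >= 0].

    If the conjugates [g^-n h g^n], [n >= 0], stay in a compact set, then
    [g^n x] and [h g^n x] stay at bounded distance, so [h] fixes their common
    limit [xi] (compact_orbit_stabilizer). In particular [H] contains [g] and
    every [U_+]. Moreover asymptotic rays stay at a distance bounded in terms of
    their initial distance only (asymptotic_bound), so [H] is closed
    (stabilizer_closed). If [g] is hyperbolic, an orbit of some power of [g]
    stays close to a ray of class [xi] (axis_tracks, hyperbolic_tracks); then,
    for [h] in a compact subset of [H] and along that power, the displacements
    of the [g^-n h g^n] are uniformly bounded.

    The scale of [g] is compared with the growth rate of the indices
    [|f^n(V) : V /\ f^n(V)|] for [V] a compact open subgroup of [H]. That the
    scale in [H] is at least this growth rate is clear, and that it is at most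
    the scale in [G] follows by intersecting subgroups of [G] with [H]
    (scale_closed_subgroup). What remains is that the scale in [G] is at most
    the growth rate in [H] (scale_growth). For every compact open subgroup [Y]
    of [G], the scale is at most [t := |f(Y_+) : Y_+|] (push_utrunc_cov), and
    [|f^n(Y_+) : Y_+| = t^n]. The point is to find [Y] such that [Y_+] is
    contained in [H] and the intersection of a compact set with [f^n(Y_+)] is
    covered by a number of cosets of [Y_+] bounded independently of [n]. This is
    Willis's tidying procedure: starting with [U] such that [U = U_+ U_-]
    (exists_tidy_above), the closure [L] of the group of elements whose orbit is
    eventually in [U] in both directions is compact (homoclinic_bounded), and
    [Y := E L], with [E] small and normalized by [L], satisfies [Y_+ <= U_+ L],
    by a shadowing argument, and has the required property (tidying).

    For the modular function, right invariance of the measure gives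
    [|f^n(V) : V /\ f^n(V)| = Delta(g)^n |V : V /\ f^n(V)|] (modular_index).
    When the action is proper and [g] is hyperbolic, the second index is bounded
    along the multiples of some [j], since the [f^-n(V)] then lie in a compact
    set; so the growth rate is [Delta(g)] (scale_modular). *)

Set Implicit Arguments.
Unset Strict Implicit.
Unset Printing Implicit Defensive.

Import Order.TTheory GRing.Theory Num.Theory.
Local Open Scope classical_set_scope.
Local Open Scope ring_scope.

(** * Counting cosets *)

Section Cosets.
Variable G : groupType.
Implicit Types (A B C D : set G) (s : seq G).

Lemma subgroup1 A : is_subgroup A -> A 1%g. Proof. by case. Qed.
Lemma subgroupM A x y : is_subgroup A -> A x -> A y -> A (x * y)%g.
Proof. by case=> _ + _; apply. Qed.
Lemma subgroupV A x : is_subgroup A -> A x -> A (x^-1)%g.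
Proof. by case=> _ _; apply. Qed.

Lemma subgroup_div A x y : is_subgroup A -> A x -> A y -> A (x^-1 * y)%g.
Proof. by move=> sA Ax Ay; apply: subgroupM => //; exact: subgroupV. Qed.

Lemma subgroup_divK A x y : is_subgroup A -> A x -> A (x^-1 * y)%g -> A y.
Proof. by move=> sA Ax Axy; rewrite -(mulVKg x y); exact: subgroupM. Qed.

Lemma subgroup_divC A x y : is_subgroup A -> A (x^-1 * y)%g -> A (y^-1 * x)%g.
Proof. by move=> sA /(subgroupV sA); rewrite invgM invgK. Qed.

Lemma subgroup_div_trans A x y z : is_subgroup A ->
  A (x^-1 * y)%g -> A (y^-1 * z)%g -> A (x^-1 * z)%g.
Proof.
by move=> sA Axy Ayz; have := subgroupM sA Axy Ayz; rewrite -mulgA mulVKg.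
Qed.

Lemma subgroupI A B : is_subgroup A -> is_subgroup B -> is_subgroup (A `&` B).
Proof.
move=> sA sB; split; first by split; exact: subgroup1.
  by move=> x y [? ?] [? ?]; split; exact: subgroupM.
by move=> x [? ?]; split; exact: subgroupV.
Qed.

(** [coset_cover A B s]: the left translates of [B] by the elements of [s]
    cover [A]. *)
Definition coset_cover A B s :=
  forall x, A x -> exists2 y, y \in s & B (y^-1 * x)%g.

(** [cov A B n]: the set [A] is covered by at most [n] left translates of [B].
    Allowing arbitrary sets, and [B] not contained in [A], makes the bounds on
    indices monotone and transitive without further conditions. *)
Definition cov A B (n : nat) := exists2 s, (size s <= n)%N & coset_cover A B s.

(** A left transversal of [A] modulo the subgroup [B]: one element of [A] in
    each coset of [B] that meets [A].  [B] need not be contained in [A]. *)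
Definition coset_reps A B s :=
  [/\ uniq s, (forall y, y \in s -> A y),
      (forall y z, y \in s -> z \in s -> B (y^-1 * z)%g -> y = z)
    & coset_cover A B s].

Lemma cov_sub A B A' B' n : A' `<=` A -> B `<=` B' -> cov A B n -> cov A' B' n.
Proof.
move=> sA sB [s ss cs]; exists s => // x /sA /cs[y ys Bxy].
by exists y => //; exact: sB.
Qed.

Lemma cov_trans A B C m n : cov A B m -> cov B C n -> cov A C (m * n).
Proof.
move=> [s sm cs] [r rn cr]; exists [seq (y * z)%g | y <- s, z <- r].
  by rewrite size_allpairs leq_mul.
move=> x /cs[y ys /cr[z zr Cz]]; exists (y * z)%g; first exact: allpairs_f.
by rewrite invgM -mulgA.
Qed.

Lemma coset_reps_le_cover A B s r : is_subgroup B ->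
  coset_reps A B s -> coset_cover A B r -> (size s <= size r)%N.
Proof.
move=> sB [us sA sep _] cr.
have /(_ _)/cid2 c_ : forall y : {y | y \in s}, exists2 z, z \in r & B (z^-1 * sval y)%g.
  by move=> [y ys]; exact/cr/sA.
pose c y := if pselect (y \in s) is left ys then s2val (c_ (exist _ y ys)) else y.
have cP y : y \in s -> c y \in r /\ B ((c y)^-1 * y)%g.
  by rewrite /c; case: pselect => // ys _; case: (c_ _).
rewrite -(size_map c); apply: uniq_leq_size.
  rewrite map_inj_in_uniq// => y z ys zs cyz; apply: sep => //.
  have [_ By] := cP _ ys; have [_ Bz] := cP _ zs; rewrite -cyz in Bz.
  exact: (subgroup_div_trans sB (subgroup_divC sB By) Bz).
by move=> _ /mapP[y ys ->]; case: (cP _ ys).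
Qed.

Lemma coset_reps_size A B s r : is_subgroup B ->
  coset_reps A B s -> coset_reps A B r -> size s = size r.
Proof.
move=> sB ts tr; apply/eqP; rewrite eqn_leq.
have [_ _ _ cs] := ts; have [_ _ _ cr] := tr.
by rewrite (coset_reps_le_cover sB ts cr) (coset_reps_le_cover sB tr cs).
Qed.

(** Discarding the superfluous translates, and taking the others at points of
    [A], turns a cover into a transversal. *)
Lemma cov_coset_reps A B n : is_subgroup B -> cov A B n ->
  exists2 s, (size s <= n)%N & coset_reps A B s.
Proof.
move=> sB [r rn cr].
suff [s [sr us sA sep cs]] : exists s, [/\ (size s <= size r)%N, uniq s,
    (forall y, y \in s -> A y),
    (forall y z, y \in s -> z \in s -> B (y^-1 * z)%g -> y = z)
    & forall x, A x -> (exists2 y, y \in r & B (y^-1 * x)%g) ->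
        exists2 y, y \in s & B (y^-1 * x)%g].
  exists s; first exact: leq_trans rn.
  by split=> // x Ax; apply: cs => //; exact: cr.
elim: r {n rn cr} => [|y r [s [sr us sA sep cs]]].
  by exists [::]; split=> // x _ [].
have [[x [Ax Bx nx]]|nx] := pselect (exists x, [/\ A x, B (y^-1 * x)%g &
    forall z, z \in s -> ~ B (z^-1 * x)%g]); last first.
  exists s; split=> //; first exact: leqW.
  move=> x Ax [z]; rewrite inE => /predU1P[->{z}|zr] Bx; last first.
    by apply: cs => //; exists z.
  apply: contrapT => nex; apply: nx; exists x; split=> // z zs Bzx.
  by apply: nex; exists z.
exists (x :: s); split=> //=.
- rewrite us andbT; apply/negP => xs; apply: (nx x xs).
  by rewrite mulVg; exact: subgroup1.
- by move=> z; rewrite inE => /predU1P[->//|/sA].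
- move=> z t; rewrite !inE => /predU1P[->|zs] /predU1P[->|ts]//.
  + by move=> /(subgroup_divC sB) /(nx _ ts).
  + by move=> /(nx _ zs).
  + exact: sep.
- move=> z Az [t]; rewrite inE => /predU1P[->|tr] Bt.
    exists x; first by rewrite inE eqxx.
    exact: (subgroup_div_trans sB (subgroup_divC sB Bx) Bt).
  have [|u us' Bu] := cs z Az; first by exists t.
  by exists u => //; rewrite inE us' orbT.
Qed.

Lemma coset_reps_cov A B s : coset_reps A B s -> cov A B (size s).
Proof. by case=> *; exists s. Qed.

Lemma cov_setI A B D n : is_subgroup B -> is_subgroup D ->
  cov A B n -> cov (A `&` D) (B `&` D) n.
Proof.
move=> sB sD AB; have [s sn [_ sA _ cs]] : exists2 s, (size s <= n)%N &
    coset_reps (A `&` D) B s.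
  by apply: cov_coset_reps => //; apply: cov_sub AB => // x [].
exists s => // x [Ax Dx]; have [y ys By] := cs x (conj Ax Dx).
by exists y => //; split=> //; apply: subgroup_div => //; case: (sA _ ys).
Qed.

Lemma coset_reps_mul A B C s r : is_subgroup A -> is_subgroup B -> is_subgroup C ->
  B `<=` A -> C `<=` B -> coset_reps A B s -> coset_reps B C r ->
  coset_reps A C [seq (y * z)%g | y <- s, z <- r].
Proof.
move=> sgA sgB sgC BA CB [us sA seps cs] [ur rB sepr cr].
have inj y z y' z' : y \in s -> z \in r -> y' \in s -> z' \in r ->
    C ((y * z)^-1 * (y' * z'))%g -> y = y' /\ z = z'.
  move=> ys zr ys' zr'; rewrite invgM -mulgA => Cyz.
  have yy' : y = y'.
    apply: seps => //; have := subgroupM sgB (subgroupM sgB (rB _ zr) (CB _ Cyz))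
      (subgroupV sgB (rB _ zr')).
    by rewrite mulVKg -!mulgA mulgV mulg1.
  by split=> //; apply: sepr => //; rewrite -yy' mulKg in Cyz.
split.
- apply: allpairs_uniq => // -[y z] [y' z'] /allpairsP[[a b] /= [ar br [-> ->]]].
  move=> /allpairsP[[a' b'] /= [ar' br' [-> ->]]] /= E.
  have [|-> ->//] := inj a b a' b' ar br ar' br'.
  by rewrite -E mulVg; exact: subgroup1.
- by move=> _ /allpairsP[[y z] /= [ys zr ->]]; apply: subgroupM; [|exact: sA|exact/BA/rB].
- move=> _ _ /allpairsP[[y z] /= [ys zr ->]] /allpairsP[[y' z'] /= [ys' zr' ->]].
  by move=> /inj[]// -> ->.
- move=> x /cs[y ys /cr[z zr Cz]]; exists (y * z)%g; first exact: allpairs_f.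
  by rewrite invgM -mulgA.
Qed.

End Cosets.

Lemma has_indexP (G : topGroupType) (A B : set G) n : is_subgroup B ->
  has_index A B n <-> exists2 s, size s = n & coset_reps A B s.
Proof.
move=> sB.
have ltE x y : left_translate x B = left_translate y B <-> B (x^-1 * y)%g.
  split=> [E|Bxy].
    have : left_translate y B y by exists 1%g; [exact: subgroup1|rewrite mulg1].
    by rewrite -E => -[b Bb <-]; rewrite mulKg.
  apply/seteqP; split=> _ [b Bb <-].
    exists (y^-1 * x * b)%g; last by rewrite mulgA mulVKg.
    by apply: subgroupM => //; exact: subgroup_divC.
  by exists (x^-1 * y * b)%g; [exact: subgroupM|rewrite mulgA mulVKg].
have dir m : has_index A B m -> exists2 s, size s = m & coset_reps A B s.
  move=> AB; have fAB : finite_set (left_cosets A B) by apply/finite_setP; exists m.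
  have := card_fset_set AB; have := in_fset_set fAB.
  set t := finmap.enum_fset _ => tE st.
  have {}tE c : c \in t <-> left_cosets A B c.
    by have := tE c; rewrite [LHS](_ : _ = (c \in t))// => ->; rewrite inE.
  have /(_ _)/cid2 r_ : forall c : {c | c \in t}, exists2 x, A x & left_translate x B = sval c.
    by move=> [c /= /tE[x Ax <-]]; exists x.
  pose r c := if pselect (c \in t) is left ct then s2val (r_ (exist _ c ct)) else 1%g.
  have rP c : c \in t -> A (r c) /\ left_translate (r c) B = c.
    by rewrite /r; case: pselect => // ct _; case: (r_ _).
  exists (map r t); first by rewrite size_map.
  split.
  - rewrite map_inj_in_uniq ?finmap.fset_uniq// => c d ct dt.
    by have [_ {2}<-] := rP _ ct; have [_ {2}<-] := rP _ dt => ->.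
  - by move=> _ /mapP[c ct ->]; case: (rP _ ct).
  - move=> _ _ /mapP[c ct ->] /mapP[d dt ->] /ltE.
    by have [_ ->] := rP _ ct; have [_ ->] := rP _ dt => ->.
  - move=> x Ax; have xt : left_translate x B \in t by apply/tE; exists x.
    exists (r (left_translate x B)); first exact: map_f.
    by apply/ltE; case: (rP _ xt).
split=> [/dir//|[s <- ts]].
have [_ sA _ cs] := ts.
have : finite_set (left_cosets A B).
  apply: (@sub_finite_set _ _ ((fun x => left_translate x B) @` [set` s])).
    move=> _ [x Ax <-]; have [y ys By] := cs _ Ax; exists y => //.
    exact/ltE.
  exact/finite_image/finite_seq.
move=> /finite_setP[m AB]; have [r rm tr] := dir _ AB.
by rewrite (coset_reps_size sB ts tr) rm.
Qed.


(** * Compactness in topological groups *)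

Lemma compact_decreasing (T : topologicalType) (D : nat -> set T) :
  compact (D 0%N) -> (forall n, closed (D n)) ->
  (forall n, D n.+1 `<=` D n) -> (forall n, D n !=set0) ->
  exists x, forall n, D n x.
Proof.
move=> cD clD dD /choice[u uD].
have dD' n m : D (n + m)%N `<=` D n.
  by elim: m => [|m IH] x; [rewrite addn0|rewrite addnS => /dD/IH].
have ev n : (u @ \oo) (D n).
  exists n => // m /= nm; apply: (@dD' n (m - n)%N); rewrite subnKC//.
have [|x [_ clx]] := cD (u @ \oo) _; first exact: ev.
exists x => n; apply: clD; move: clx; rewrite clusterE => /(_ (D n)); apply.
exact: ev.
Qed.

Section TopGroup.
Variable G : topGroupType.
Implicit Types (x y : G) (A B U V : set G).

Lemma mull_continuous x : continuous (fun y : G => (x * y)%g).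
Proof.
move=> y; apply: (@continuous_comp _ _ _ (fun y : G => (x, y))
  (fun p : G * G => (p.1 * p.2)%g)); last exact: mulg_continuous.
by apply: cvg_pair => //; exact: cvg_cst.
Qed.

Lemma mulr_continuous x : continuous (fun y : G => (y * x)%g).
Proof.
move=> y; apply: (@continuous_comp _ _ _ (fun y : G => (y, x))
  (fun p : G * G => (p.1 * p.2)%g)); last exact: mulg_continuous.
by apply: cvg_pair => //; exact: cvg_cst.
Qed.

Lemma open_preim (S T : topologicalType) (f : S -> T) (A : set T) :
  continuous f -> open A -> open (f @^-1` A).
Proof. by move=> /continuousP; apply. Qed.

Lemma closed_preim (S T : topologicalType) (f : S -> T) (A : set T) :
  continuous f -> closed A -> closed (f @^-1` A).
Proof. by move=> /continuous_closedP; apply. Qed.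

Lemma compact_image (S T : topologicalType) (f : S -> T) (A : set S) :
  continuous f -> compact A -> compact (f @` A).
Proof.
move=> cf cA; apply: continuous_compact => //; exact: continuous_subspaceT.
Qed.

Lemma open_subgroup_closed U : is_subgroup U -> open U -> closed U.
Proof.
move=> sU oU x clx.
have : nbhs x (fun y => U (x^-1 * y)%g).
  apply: open_nbhs_nbhs; split; last by rewrite /= mulVg; exact: subgroup1.
  exact: open_preim (@mull_continuous _) oU.
move=> /clx[y [Uy Uxy]].
by have := subgroupM sU Uy (subgroupV sU Uxy); rewrite invgM invgK mulVKg.
Qed.

(** The translates can be taken at points of [A] itself; so, if [A] lies in a
    subgroup, [O] can be replaced by its trace on that subgroup. *)
Lemma compact_coset_cover A O : compact A -> open O -> O 1%g ->
  exists2 s, (forall y, y \in s -> A y) & coset_cover A O s.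
Proof.
move=> cA oO O1.
have /(_ G A (fun y => [set x | O (y^-1 * x)%g])) : cover_compact A.
  by have := @compact_cover (pointed_group G) => <-.
case=> [y Ay|x Ax|D DA cD].
- exact: open_preim (@mull_continuous _) oO.
- by exists x => //=; rewrite mulVg.
- exists (finmap.enum_fset D); first by move=> y /DA; rewrite inE.
  by move=> x /cD[y /= yD Oy]; exists y.
Qed.

Lemma compact_cov A B : compact A -> open B -> B 1%g -> exists n, cov A B n.
Proof. by move=> cA oB B1; have [s _ cs] := compact_coset_cover cA oB B1; exists (size s), s. Qed.

(** The product set. *)
Definition pmul A B : set G := [set (a * b)%g | a in A & b in B].

Lemma compact_pmul A B : compact A -> compact B -> compact (pmul A B).
Proof.
move=> cA cB; have -> : pmul A B = (fun p : G * G => (p.1 * p.2)%g) @` (A `*` B).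
  apply/seteqP; split=> [_ [a Aa [b Bb <-]]|_ [[a b] [/= Aa Bb] <-]].
    by exists (a, b).
  by exists a => //; exists b.
by apply: compact_image; [exact: mulg_continuous|exact: compact_setX].
Qed.

Lemma closure_subgroup A : is_subgroup A -> is_subgroup (closure A).
Proof.
move=> sA; have clP (x : G) : closure A x -> forall O, open O -> O x -> exists y, A y /\ O y.
  by move=> clx O oO Ox; apply: clx; exact: open_nbhs_nbhs.
split; first by apply: subset_closure; exact: subgroup1.
- move=> x y clx cly O; rewrite nbhsE => - [W [oW Wxy] sO].
  have [x' [Ax' Wx']] := clP x clx _ (open_preim (@mulr_continuous y) oW) Wxy.
  have [y' [Ay' Wy']] := clP y cly _ (open_preim (@mull_continuous x') oW) Wx'.
  by exists (x' * y')%g; split; [exact: subgroupM|exact: sO].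
- move=> x clx O; rewrite nbhsE => - [W [oW Wx] sO].
  have [x' [Ax' Wx']] := clP x clx _ (open_preim (@invg_continuous G) oW) Wx.
  by exists (x'^-1)%g; split; [exact: subgroupV|exact: sO].
Qed.

End TopGroup.

(** * Automorphisms of topological groups *)

(** A topological automorphism [fwd], given together with its inverse. *)
Record taut (G : topGroupType) := Taut {
  fwd : G -> G ;
  bwd : G -> G ;
  fwdM : {morph fwd : x y / (x * y)%g} ;
  fwdK : cancel fwd bwd ;
  bwdK : cancel bwd fwd ;
  fwd_cont : continuous fwd ;
  bwd_cont : continuous bwd
}.

Section Taut.
Variables (G : topGroupType).
Implicit Types (f : taut G) (U : set G).

Lemma bwdM f : {morph bwd f : x y / (x * y)%g}.
Proof.
by move=> x y; apply: (can_inj (fwdK f)); rewrite fwdM !bwdK.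
Qed.

(** The inverse automorphism. *)
Definition tinv f : taut G :=
  Taut (@bwdM f) (@bwdK _ f) (@fwdK _ f) (@bwd_cont _ f) (@fwd_cont _ f).

Lemma fwd1 f : fwd f 1%g = 1%g.
Proof. by apply: (mulgI (fwd f 1%g)); rewrite -fwdM !mulg1. Qed.

Lemma fiterM f n : {morph iter n (fwd f) : x y / (x * y)%g}.
Proof. by move=> x y; elim: n => //= n ->; rewrite fwdM. Qed.

Lemma fiter1 f n : iter n (fwd f) 1%g = 1%g.
Proof. by elim: n => //= n ->; rewrite fwd1. Qed.

Lemma fiterV f n x : iter n (fwd f) (x^-1)%g = ((iter n (fwd f) x)^-1)%g.
Proof. by apply: (mulgI (iter n (fwd f) x)); rewrite -fiterM !mulgV fiter1. Qed.

Lemma fwdV f x : fwd f (x^-1)%g = ((fwd f x)^-1)%g.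
Proof. exact: (fiterV f 1). Qed.

Lemma fiterK f n : cancel (iter n (fwd f)) (iter n (bwd f)).
Proof. by elim: n => // n IH x; rewrite iterSr/= fwdK IH. Qed.

Lemma iter_cont f n : continuous (iter n (fwd f)).
Proof.
elim: n => [|n IH] x; first exact: cvg_id.
by apply: (@continuous_comp _ _ _ (iter n (fwd f))); [exact: IH|exact: fwd_cont].
Qed.

Lemma biterM f n : {morph iter n (bwd f) : x y / (x * y)%g}.
Proof. exact: (fiterM (tinv f)). Qed.
Lemma biter1 f n : iter n (bwd f) 1%g = 1%g.
Proof. exact: (fiter1 (tinv f)). Qed.
Lemma biterV f n x : iter n (bwd f) (x^-1)%g = ((iter n (bwd f) x)^-1)%g.
Proof. exact: (fiterV (tinv f)). Qed.
Lemma biterK f n : cancel (iter n (bwd f)) (iter n (fwd f)).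
Proof. exact: (fiterK (tinv f)). Qed.
Lemma biter_cont f n : continuous (iter n (bwd f)).
Proof. exact: (@iter_cont (tinv f)). Qed.

Lemma biter_iter f m n x : iter m (bwd f) (iter (m + n) (fwd f) x) = iter n (fwd f) x.
Proof. by rewrite iterD fiterK. Qed.

Lemma iter_biter f m n x : iter m (fwd f) (iter (m + n) (bwd f) x) = iter n (bwd f) x.
Proof. by rewrite iterD biterK. Qed.

(** The image of a set under the [n]-th power of [f]. *)
Definition push f n U : set G := iter n (bwd f) @^-1` U.

(** [uplus f U] is the subgroup [U_+], the intersection of the [f^n(U)] for
    [n >= 0]; [uplus (tinv f) U] is [U_-]. *)
Definition uplus f U : set G := [set x | forall n, U (iter n (bwd f) x)].

(** The intersection of the [f^i(U)] for [i <= n]. *)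
Definition utrunc f n U : set G :=
  [set x | forall i, (i <= n)%N -> U (iter i (bwd f) x)].

Lemma push_subgroup f n U : is_subgroup U -> is_subgroup (push f n U).
Proof.
move=> sU; split; rewrite /push /=.
- by rewrite biter1; exact: subgroup1.
- by move=> x y /= ? ?; rewrite biterM; exact: subgroupM.
- by move=> x /= ?; rewrite biterV; exact: subgroupV.
Qed.

Lemma uplus_subgroup f U : is_subgroup U -> is_subgroup (uplus f U).
Proof.
move=> sU; split; rewrite /uplus /=.
- by move=> n; rewrite biter1; exact: subgroup1.
- by move=> x y /= ? ? n; rewrite biterM; exact: subgroupM.
- by move=> x /= ? n; rewrite biterV; exact: subgroupV.
Qed.

Lemma utrunc_subgroup f n U : is_subgroup U -> is_subgroup (utrunc f n U).
Proof.
move=> sU; split; rewrite /utrunc /=.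
- by move=> i _; rewrite biter1; exact: subgroup1.
- by move=> x y /= hx hy i ni; rewrite biterM; apply: subgroupM => //; [exact: hx|exact: hy].
- by move=> x /= hx i ni; rewrite biterV; apply: subgroupV => //; exact: hx.
Qed.

Lemma uplus_closed f U : closed U -> closed (uplus f U).
Proof.
move=> cU; have -> : uplus f U = \bigcap_n (iter n (bwd f) @^-1` U).
  by apply/seteqP; split=> x h n => [_|]; exact: h.
by apply: closed_bigI => n _; exact: closed_preim (@biter_cont f n) cU.
Qed.

Lemma utrunc_closed f n U : closed U -> closed (utrunc f n U).
Proof.
move=> cU; have -> : utrunc f n U = \bigcap_(i in [set i | (i <= n)%N]) (iter i (bwd f) @^-1` U).
  by apply/seteqP; split=> x h i; exact: h.
by apply: closed_bigI => i _; exact: closed_preim (@biter_cont f i) cU.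
Qed.

Lemma utrunc_open f n U : open U -> open (utrunc f n U).
Proof.
move=> oU; elim: n => [|n IH].
  have -> : utrunc f 0 U = U; last by [].
  by apply/seteqP; split=> [x /(_ 0%N)|x Ux i]; [exact|rewrite leqn0 => /eqP->].
have -> : utrunc f n.+1 U = utrunc f n U `&` (iter n.+1 (bwd f) @^-1` U).
  apply/seteqP; split=> [x h|x [h h'] i].
    by split; [move=> i ni; apply: h; exact: leqW|exact: h].
  by rewrite leq_eqVlt => /predU1P[->//|]; exact: h.
by apply: openI => //; exact: open_preim (@biter_cont f n.+1) oU.
Qed.

Lemma uplus_sub f U : uplus f U `<=` U.
Proof. by move=> x /(_ 0%N). Qed.

Lemma utrunc_sub f n U : utrunc f n U `<=` U.
Proof. by move=> x /(_ 0%N); exact. Qed.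

Lemma uplus_bwd f U x : uplus f U x -> uplus f U (bwd f x).
Proof. by move=> h n; rewrite -iterSr; exact: h. Qed.

Lemma uplus_biter f U n x : uplus f U x -> uplus f U (iter n (bwd f) x).
Proof. by move=> h; elim: n => //= n; exact: uplus_bwd. Qed.

Lemma uplus_utrunc f n U : uplus f (utrunc f n U) = uplus f U.
Proof.
apply/seteqP; split=> x h m; first exact: (h m 0%N).
by move=> i _; rewrite -iterD; exact: h.
Qed.

Lemma utrunc_cos f n U : hausdorff_space G -> compact_open_subgroup U ->
  compact_open_subgroup (utrunc f n U).
Proof.
move=> hG [sU cU oU]; split.
- exact: utrunc_subgroup.
- apply: (subclosed_compact _ cU); last exact: utrunc_sub.
  by apply: utrunc_closed; exact: compact_closed.
- exact: utrunc_open.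
Qed.

Lemma uplus_compact f U : hausdorff_space G -> compact U -> compact (uplus f U).
Proof.
move=> hG cU; apply: (subclosed_compact _ cU); last exact: uplus_sub.
by apply: uplus_closed; exact: compact_closed.
Qed.

Lemma push_compact f n U : compact U -> compact (push f n U).
Proof.
move=> cU; have -> : push f n U = iter n (fwd f) @` U.
  apply/seteqP; split=> [x Ux|_ [x Ux <-]]; last by rewrite /push/= fiterK.
  by exists (iter n (bwd f) x) => //; rewrite biterK.
by apply: compact_image cU; exact: iter_cont.
Qed.

Lemma push_open f n U : open U -> open (push f n U).
Proof. by move=> oU; exact: open_preim (@biter_cont f n) oU. Qed.

Lemma pushD f m n U : push f (m + n) U = push f m (push f n U).
Proof. by apply/funext => x; rewrite /push /preimage /= addnC iterD. Qed.

Lemma push_cov f k A B n : cov A B n -> cov (push f k A) (push f k B) n.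
Proof.
move=> [s sn cs]; exists (map (iter k (fwd f)) s); first by rewrite size_map.
move=> x /cs[y ys By]; exists (iter k (fwd f) y); first exact: map_f.
by rewrite /push/= biterM biterV fiterK.
Qed.

Lemma cov_iter f A n k : cov (push f 1 A) A k -> cov (push f n A) A (k ^ n).
Proof.
move=> h; elim: n => [|n IH].
  exists [:: 1%g] => // x Ax; exists 1%g; first by rewrite inE.
  by rewrite invg1 mul1g.
rewrite -addn1 pushD expnD expn1 mulnC.
by apply: cov_trans IH; exact: push_cov.
Qed.

End Taut.

(** * Subgroups tidy above, and homoclinic elements *)

Lemma seq_uniform_bound (T : eqType) (s : seq T) (P : T -> nat -> Prop) :
  (forall y m n, (m <= n)%N -> P y m -> P y n) ->
  (forall y, y \in s -> exists n, P y n) ->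
  exists n, forall y, y \in s -> P y n.
Proof.
move=> mP; elim: s => [|y s IH] h; first by exists 0%N.
have [|n hn] := IH; first by move=> z zs; apply: h; rewrite inE zs orbT.
have [|m hm] := h y; first by rewrite inE eqxx.
exists (maxn m n) => z; rewrite inE => /predU1P[->|zs].
  by apply: mP hm; exact: leq_maxl.
by apply: mP (hn _ zs); exact: leq_maxr.
Qed.

Section Tidy.
Variable G : topGroupType.
Hypothesis hG : hausdorff_space G.
Implicit Types (f : taut G) (U Y : set G).

Lemma push1E f U x : push f 1 U x = U (bwd f x). Proof. by []. Qed.

Lemma cos_closed U : compact_open_subgroup U -> closed U.
Proof. by case=> _ cU _; exact: compact_closed. Qed.

Lemma push_uplus_fin_index f Y : compact_open_subgroup Y ->
  exists s, coset_reps (push f 1 (uplus f Y)) (uplus f Y) s.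
Proof.
move=> cosY; have [sY cY oY] := cosY.
have sp := uplus_subgroup f sY.
have [n cn] := compact_cov (push_compact (f:=f) (n:=1%N) cY) oY (subgroup1 sY).
have [] := @cov_coset_reps _ (push f 1 (uplus f Y)) (uplus f Y) n sp; last by move=> s _; exists s.
have sS := push_subgroup f 1 sp.
have := @cov_setI _ (push f 1 (uplus f Y)) Y _ n sY sS; case.
  by apply: cov_sub cn => // x; rewrite !push1E => /uplus_sub.
move=> s sn cs; exists s => // x hx; have [|y ys [Yy]] := cs x; first by [].
rewrite push1E => py; exists y => // -[//|k].
by rewrite iterSr; exact: py.
Qed.

(** With [Y_n = utrunc f n Y], the sets of cosets of [Y] that meet [f(Y_n)] form
    a decreasing sequence of finite sets. By compactness, its limit is the set
    of cosets that meet [f(Y_+)]; hence [f(Y_n)] is contained in [f(Y_+) Y] for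
    some [n]. *)
Lemma utrunc_factor f Y : compact_open_subgroup Y ->
  exists n, forall x, utrunc f n Y x ->
    exists2 v, uplus f Y v & utrunc f n.+1 Y (fwd f (v^-1 * x)%g).
Proof.
move=> cosY; have [sY cY oY] := cosY; have clY := cos_closed cosY.
have [n0 cn] := compact_cov (push_compact (f:=f) (n:=1%N) cY) oY (subgroup1 sY).
have [s _ [_ _ _ cs]] := cov_coset_reps sY cn.
pose good y := exists2 v, uplus f Y v & Y (y^-1 * fwd f v)%g.
pose P y n := good y \/ forall x, utrunc f n Y x -> ~ Y (y^-1 * fwd f x)%g.
have [|y _|n hn] := @seq_uniform_bound _ s P.
- move=> y m n mn [gy|h]; [by left|right => x hx; apply: h => i im].
  by apply: hx; exact: leq_trans mn.
- rewrite /P; have [gy|ngy] := pselect (good y); first by exists 0%N; left.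
  suff [n hn] : exists n, forall x, utrunc f n Y x -> ~ Y (y^-1 * fwd f x)%g.
    by exists n; right.
  apply: contrapT => nex; apply: ngy.
  pose D n := utrunc f n Y `&` [set x | Y (y^-1 * fwd f x)%g].
  have clD n : closed (D n).
    apply: closedI; first exact: utrunc_closed.
    have : continuous (fun x : G => (y^-1 * fwd f x)%g).
      move=> x; apply: continuous_comp; first exact: fwd_cont.
      exact: mull_continuous.
    by move=> /closed_preim; apply.
  have [||||x hx] := @compact_decreasing _ D.
  + apply: (subclosed_compact _ cY) => // x [h _].
    exact: utrunc_sub h.
  + exact: clD.
  + by move=> n x [h ?]; split=> // i im; apply: h; exact: leqW.
  + move=> n; apply/set0P/negP => /eqP D0; apply: nex; exists n => x hx Yx.
    by have : D n x by []; rewrite D0.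
  + exists x; first by move=> i; have [h _] := hx i; apply: h.
    by have [_] := hx 0%N.
exists n => x hx.
have [y ys Yy] : exists2 y, y \in s & Y (y^-1 * fwd f x)%g.
  by apply: cs; rewrite push1E fwdK; exact: utrunc_sub hx.
have [[v pv Yv]|h] := hn y ys; last by case: (h x hx Yy).
exists v => // -[_|i ni].
  have -> : iter 0 (bwd f) (fwd f (v^-1 * x)%g) = ((fwd f v)^-1 * fwd f x)%g.
    by rewrite /= fwdM fwdV.
  exact: (subgroup_div_trans sY (subgroup_divC sY Yv) Yy).
rewrite iterSr fwdK biterM biterV; apply: subgroup_div => //.
by apply: hx; rewrite -ltnS.
Qed.

(** The minimum of the indices of the [U /\ f(U)] in [f(U)] is at most the index
    of [Y_+] in [f(Y_+)], for every compact open subgroup [Y]. *)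
Lemma push_utrunc_cov f Y s : compact_open_subgroup Y ->
  coset_reps (push f 1 (uplus f Y)) (uplus f Y) s ->
  exists2 U, compact_open_subgroup U & cov (push f 1 U) U (size s).
Proof.
move=> cosY [_ _ _ cs]; have [n hn] := utrunc_factor f cosY.
have [sY _ _] := cosY.
exists (utrunc f n Y); first exact: utrunc_cos.
exists s => // x; rewrite push1E => hx.
have [v pv] := hn _ hx; rewrite fwdM bwdK => Tvx.
have [|y ys py] := cs (fwd f v); first by rewrite push1E fwdK.
exists y => //; have sT := utrunc_subgroup f n sY.
have {}Tvx : utrunc f n Y ((fwd f v)^-1 * x)%g.
  have -> : ((fwd f v)^-1)%g = fwd f (v^-1)%g by rewrite fwdV.
  by move=> i ni; apply: Tvx; exact: leqW.
by apply: (subgroup_div_trans sT _ Tvx) => i _; exact: py.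
Qed.

(** Every element of [U] is a product of an element of [U_+] and one of
    [U_-]. *)
Definition tidy_above f U :=
  forall x, U x -> exists2 v, uplus f U v & uplus (tinv f) U (v^-1 * x)%g.

(** The group [U = utrunc f n Y] satisfies [U = U_+ (U /\ f^-1(U))]; iterating
    this factorization, and by compactness, [U = U_+ U_-]. *)
Lemma exists_tidy_above f Y : compact_open_subgroup Y ->
  exists2 U, compact_open_subgroup U & tidy_above f U.
Proof.
move=> cosY; have [n hn] := utrunc_factor f cosY.
set U := utrunc f n Y; have cosU : compact_open_subgroup U by exact: utrunc_cos.
have [sU cU oU] := cosU; have clU := cos_closed cosU.
exists U => // x Ux.
have pU : uplus f U = uplus f Y by exact: uplus_utrunc.
have step w : U w -> exists2 v, uplus f U v & U (v^-1 * w)%g /\ U (fwd f (v^-1 * w)%g).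
  move=> Uw; have [v pv Tv] := hn _ Uw; exists v; first by rewrite pU.
  split; last by move=> i ni; apply: Tv; exact: leqW.
  by move=> i ni; have := Tv i.+1 ni; rewrite iterSr fwdK.
pose D k := [set v | uplus f U v /\ forall i, (i <= k)%N -> U (iter i (fwd f) (v^-1 * x)%g)].
have DE k : D k = uplus f U `&` (fun v => v^-1 * x)%g @^-1` (utrunc (tinv f) k U) by [].
have clD k : closed (D k).
  rewrite DE; apply: closedI; first exact: uplus_closed.
  have : continuous (fun v : G => (v^-1 * x)%g).
    move=> v; apply: (@continuous_comp _ _ _ (fun v : G => v^-1)%g
      (fun w : G => (w * x)%g)); first exact: invg_continuous.
    exact: mulr_continuous.
  by move=> /closed_preim; apply; exact: utrunc_closed.
have [||||v hv] := @compact_decreasing _ D.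
- apply: (subclosed_compact _ cU) => // v [pv _].
  exact: uplus_sub pv.
- exact: clD.
- by move=> k v [pv h]; split=> // i ik; apply: h; exact: leqW.
- elim=> [|k [v [pv h]]].
    exists 1%g; split; first by apply: subgroup1; exact: uplus_subgroup.
    by move=> i; rewrite leqn0 => /eqP->; rewrite invg1 mul1g.
  have [w pw [_ Uw2]] := step _ (h k (leqnn k)).
  have pbw := uplus_biter k pw.
  exists (v * iter k (bwd f) w)%g; split; first exact: (subgroupM (uplus_subgroup f sU)).
  move=> i; rewrite leq_eqVlt => /predU1P[->|].
    by rewrite iterS invgM -mulgA fiterM fiterV biterK.
  rewrite ltnS => ik; rewrite invgM -mulgA fiterM fiterV.
  apply: (subgroup_div sU); last exact: h.
  by rewrite -(subnKC ik) iter_biter; exact: pw.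
exists v; first by case: (hv 0%N).
by move=> i; have [_ h] := hv i; apply: h.
Qed.

(** The elements whose orbit is eventually in [U], both forwards and
    backwards. *)
Definition homoclinic f U : set G :=
  [set x | exists N, forall n, (N <= n)%N -> U (iter n (fwd f) x) /\ U (iter n (bwd f) x)].

Lemma homoclinic_subgroup f U : is_subgroup U -> is_subgroup (homoclinic f U).
Proof.
move=> sU; split.
- by exists 0%N => n _; rewrite fiter1 biter1; split; exact: subgroup1.
- move=> x y [N hN] [M hM]; exists (maxn N M) => n; rewrite geq_max => /andP[/hN[? ?] /hM[? ?]].
  by rewrite fiterM biterM; split; exact: subgroupM.
- by move=> x [N hN]; exists N => n /hN[? ?]; rewrite fiterV biterV; split; exact: subgroupV.
Qed.

Lemma homoclinic_fwd f U x : homoclinic f U x -> homoclinic f U (fwd f x).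
Proof.
move=> [N hN]; exists N.+1 => -[//|n]; rewrite ltnS => Nn; split.
  by rewrite -iterSr; case: (hN _ (leqW (leqW Nn))).
by rewrite iterSr fwdK; case: (hN _ Nn).
Qed.

Lemma homoclinic_bwd f U x : homoclinic f U x -> homoclinic f U (bwd f x).
Proof.
move=> [N hN]; exists N.+1 => -[//|n]; rewrite ltnS => Nn; split.
  by rewrite iterSr bwdK; case: (hN _ Nn).
by rewrite -iterSr; case: (hN _ (leqW (leqW Nn))).
Qed.

Lemma homoclinic_iter f U n x : homoclinic f U x -> homoclinic f U (iter n (fwd f) x).
Proof. by move=> h; elim: n => //= n; exact: homoclinic_fwd. Qed.

Lemma homoclinic_biter f U n x : homoclinic f U x -> homoclinic f U (iter n (bwd f) x).
Proof. by move=> h; elim: n => //= n; exact: homoclinic_bwd. Qed.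

(** Let [P] be the group of homoclinic elements of [U_-]. Finitely many elements
    [y] of [P] represent its cosets modulo [f(U)], so every [x] in [P] is
    [y f(x')] for one of them and some [x'] in [P]. All these [y] have their
    backward orbits in [U] from some time [N] on; by induction, after time [N]
    the backward orbit of [x] stays in [U f^-N(U)]. Every homoclinic element is
    on the backward orbit of an element of [P], after an arbitrarily late
    time. *)
Lemma homoclinic_bounded f U : compact_open_subgroup U ->
  exists N, homoclinic f U `<=` pmul U (push (tinv f) N U).
Proof.
move=> cosU; have [sU cU oU] := cosU; have clU := cos_closed cosU.
pose P := homoclinic f U `&` uplus (tinv f) U.
have sLL := homoclinic_subgroup f sU.
have sP : is_subgroup P by apply: subgroupI => //; exact: uplus_subgroup.
have [n0 cn] := compact_cov cU (push_open f 1 oU) (subgroup1 (push_subgroup f 1 sU)).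
have [s _ [_ sA _ cs]] : exists2 s, (size s <= n0)%N & coset_reps P (push f 1 U) s.
  apply: cov_coset_reps; first exact: push_subgroup.
  by apply: cov_sub cn => // x [_ /uplus_sub].
have [||N hN] := @seq_uniform_bound _ s (fun y N => forall n, (N <= n)%N -> U (iter n (bwd f) y)).
- by move=> y m n mn h k nk; apply: h; exact: leq_trans nk.
- by move=> y /sA[[N hN] _]; exists N => n /hN[].
have back x : P x -> exists2 y, y \in s & P (bwd f (y^-1 * x)%g).
  move=> Px; have [y ys Uy] := cs x Px; exists y => //.
  have [h1 h2] := subgroup_div sP (sA _ ys) Px.
  split; first exact: homoclinic_bwd.
  by case=> [//|n]; have := h2 n; rewrite /tinv/= -iterS iterSr bwdK.
have main m x : P x -> pmul U (push (tinv f) N U) (iter (N + m) (bwd f) x).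
  elim: m x => [|m IH] x Px.
    exists 1%g; first exact: subgroup1.
    exists (iter N (bwd f) x); last by rewrite addn0 mul1g.
    by rewrite /push/= biterK; case: Px => _ /uplus_sub.
  have [y ys Py] := back x Px; have [u Uu [w Uw uw]] := IH _ Py.
  exists (iter (N + m.+1) (bwd f) y * u)%g.
    by apply: subgroupM => //; apply: hN => //; exact: leq_addr.
  exists w => //; rewrite -mulgA uw addnS -[in X in (_ * X)%g]iterSr -biterM.
  by rewrite mulVKg.
exists N => x LLx; have [M hM] := LLx.
have Px : P (iter (N + M) (fwd f) x).
  split; first exact: homoclinic_iter.
  move=> n; rewrite /tinv/= -iterD.
  by case: (hM (n + (N + M))%N _) => //; rewrite addnA leq_addl.
by have := main M _ Px; rewrite fiterK.
Qed.

End Tidy.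

(** * Tidying *)

Lemma closure_map (S T : topologicalType) (h : S -> T) (A : set S) (B : set T) x :
  continuous h -> (forall y, A y -> B (h y)) -> closure A x -> closure B (h x).
Proof.
move=> ch AB clx O /ch Oh; have [y [Ay Oy]] := clx _ Oh.
by exists (h y); split => //; exact: AB.
Qed.

Section Core.
Variable G : topGroupType.
Hypothesis hG : hausdorff_space G.
Implicit Types (A O U W L : set G).

Lemma open_subgroup A O : is_subgroup A -> open O -> O 1%g -> O `<=` A -> open A.
Proof.
move=> sA oO O1 OA; rewrite openE => x Ax.
have : nbhs x (fun y => O (x^-1 * y)%g).
  apply: open_nbhs_nbhs; split; last by rewrite /= mulVg.
  exact: open_preim (@mull_continuous _ _) oO.
by apply: filterS => y /OA; exact: subgroup_divK.
Qed.

(** A compact open subgroup contains one normalized by a given compact group: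
    only finitely many conjugates matter in the intersection of all. *)
Lemma normal_core L W : is_subgroup L -> compact L -> compact_open_subgroup W ->
  exists E, [/\ compact_open_subgroup E, E `<=` W
    & forall l x, L l -> E x -> E (l * x * l^-1)%g].
Proof.
move=> sL cL [sW cW oW].
have [s sA cs] := compact_coset_cover cL oW (subgroup1 sW).
pose E := [set x | forall l, L l -> W (l^-1 * x * l)%g].
have EE : E = [set x | forall l, l \in s -> W (l^-1 * x * l)%g].
  apply/seteqP; split=> x h l; first by move=> /sA; exact: h.
  move=> Ll; have [y ys Wy] := cs l Ll.
  have -> : (l^-1 * x * l = (y^-1 * l)^-1 * ((y^-1 * x * y) * (y^-1 * l)))%g.
    by rewrite invgM invgK -!mulgA !mulVKg.
  by apply: subgroup_div => //; apply: subgroupM => //; exact: h.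
have sE : is_subgroup E.
  split.
  - by move=> l _; rewrite mulg1 mulVg; exact: subgroup1.
  - move=> x y hx hy l Ll; have := subgroupM sW (hx _ Ll) (hy _ Ll).
    by rewrite -!mulgA mulVKg.
  - move=> x hx l Ll; have := subgroupV sW (hx _ Ll).
    by rewrite !invgM invgK -!mulgA.
have EW : E `<=` W.
  by move=> x /(_ 1%g (subgroup1 sL)); rewrite invg1 mul1g mulg1.
have oE : open E.
  rewrite EE; elim: {cs sA EE} s => [|y s IH].
    by rewrite (_ : mkset _ = setT); [exact: openT|exact/seteqP].
  rewrite (_ : mkset _ = [set x | W (y^-1 * x * y)%g] `&`
                         [set x | forall l, l \in s -> W (l^-1 * x * l)%g]).
    apply: openI => //; apply: open_preim oW => x.
    apply: (@continuous_comp _ _ _ (fun x : G => (y^-1 * x)%g) (fun x : G => (x * y)%g)).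
      exact: mull_continuous.
    exact: mulr_continuous.
  apply/seteqP; split=> [x h|x [h1 h2] l].
    by split=> [|l ls]; apply: h; rewrite inE ?eqxx ?ls ?orbT.
  by rewrite inE => /predU1P[->|/h2].
exists E; split=> //.
  by split=> //; apply: subclosed_compact cW EW; exact: open_subgroup_closed.
move=> l x Ll hx k Lk; have := hx (l^-1 * k)%g (subgroup_div sL Ll Lk).
by rewrite invgM invgK !mulgA.
Qed.

Lemma pmul_cos E L : compact_open_subgroup E -> is_subgroup L -> compact L ->
  (forall l x, L l -> E x -> E (l * x * l^-1)%g) ->
  compact_open_subgroup (pmul E L).
Proof.
move=> [sE cE oE] sL cL nE.
have sY : is_subgroup (pmul E L).
  split.
  - exists 1%g; first exact: subgroup1.
    by exists 1%g; [exact: subgroup1|rewrite mulg1].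
  - move=> _ _ [e Ee [l Ll <-]] [e' Ee' [l' Ll' <-]].
    exists (e * (l * e' * l^-1))%g; first by apply: subgroupM => //; exact: nE.
    by exists (l * l')%g; [exact: subgroupM|rewrite -!mulgA mulKg].
  - move=> _ [e Ee [l Ll <-]]; exists (l^-1 * e^-1 * l)%g.
      have := nE _ _ (subgroupV sL Ll) (subgroupV sE Ee).
      by rewrite invgK.
    by exists (l^-1)%g; [exact: subgroupV|rewrite invgM mulgK].
split=> //; first exact: compact_pmul.
apply: (open_subgroup sY oE); first exact: subgroup1.
by move=> e Ee; exists e => //; exists 1%g; [exact: subgroup1|rewrite mulg1].
Qed.

End Core.

Section Growth.
Variable G : topGroupType.
Hypothesis hG : hausdorff_space G.
Variables (f : taut G) (U : set G).
Hypothesis cosU : compact_open_subgroup U.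
Hypothesis tidyU : tidy_above f U.

Let sU : is_subgroup U. Proof. by case: cosU. Qed.
Let cU : compact U. Proof. by case: cosU. Qed.
Let oU : open U. Proof. by case: cosU. Qed.

Let L := closure (homoclinic f U).

Let sL : is_subgroup L.
Proof. by apply: closure_subgroup; exact: homoclinic_subgroup. Qed.

Let cL : compact L.
Proof.
have [N LU] := homoclinic_bounded hG f cosU.
have cK : compact (pmul U (push (tinv f) N U)).
  by apply: compact_pmul => //; exact: push_compact.
apply: (subclosed_compact (@closed_closure _ _) cK).
rewrite closureE => x; apply; split => //; exact: compact_closed.
Qed.

Let Lfwd n x : L x -> L (iter n (fwd f) x).
Proof.
apply: (@closure_map _ _ _ (homoclinic f U) (homoclinic f U)); first exact: iter_cont.
by move=> y; exact: homoclinic_iter.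
Qed.

Let Lbwd n x : L x -> L (iter n (bwd f) x).
Proof.
apply: (@closure_map _ _ _ (homoclinic f U) (homoclinic f U)); first exact: biter_cont.
by move=> y; exact: homoclinic_biter.
Qed.

Let L_factor x : L x -> U x -> exists v, [/\ L v, uplus f U v,
  L (v^-1 * x)%g & uplus (tinv f) U (v^-1 * x)%g].
Proof.
move=> Lx Ux; pose K := pmul (L `&` uplus f U) (L `&` uplus (tinv f) U).
have clK : closed K.
  apply: compact_closed => //; apply: compact_pmul.
    apply: (subclosed_compact _ cL); last by move=> ? [].
    by apply: closedI; [exact: closed_closure|apply: uplus_closed; exact: compact_closed].
  apply: (subclosed_compact _ cL); last by move=> ? [].
  by apply: closedI; [exact: closed_closure|apply: uplus_closed; exact: compact_closed].
suff [v [Lv pv] [w [Lw mw] vw]] : K x by exists v; rewrite -vw mulKg.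
apply: clK => O Ox; have [|y [LLy [Oy Uy]]] := Lx (O `&` U).
  by apply: filterI => //; exact: open_nbhs_nbhs.
exists y; split=> //; have [v pv mv] := tidyU Uy.
have LLv : homoclinic f U v.
  have [N hN] := LLy; exists N => n Nn; split; last exact: pv.
  have -> : v = (y * (v^-1 * y)^-1)%g by rewrite invgM invgK mulVKg.
  rewrite fiterM fiterV; apply: subgroupM => //; first by case: (hN n Nn).
  by apply: subgroupV => //; exact: mv.
have Lv : L v by exact: subset_closure.
have Ly : L y by exact: subset_closure.
exists v => //; exists (v^-1 * y)%g; last by rewrite mulVKg.
by split=> //; exact: (subgroup_div sL Lv Ly).
Qed.

Let fix_homoclinic x : uplus f U x -> uplus (tinv f) U x -> L x.
Proof.
by move=> px mx; apply: subset_closure; exists 0%N => n _; split; [exact: mx|exact: px].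
Qed.

(** The backward orbit of a point [y] of [Y_+], with [Y = E L], is [o_k l_k] with
    [o_k] in the small group [E] and [l_k] in [L]; so the [o_k] form a backward
    orbit up to errors [err_k] in the intersection of [L] and [U]. The error
    accumulated at time [k + 1] is a product of an element of [U_+] and an
    element [p] of [U_-], both in [L]. Multiplying the starting point by
    [f^(k+1)(p^-1)] removes [p], and changes the earlier points of the orbit by
    elements of [U] only. By compactness of [L] some [o_0 z], with [z] in [L],
    has its whole backward orbit in [U]. *)
Let shadowing E y : is_subgroup E -> E `<=` U `&` push f 1 U ->
  uplus f (pmul E L) y -> exists2 v, uplus f U v & L (v^-1 * y)%g.
Proof.
move=> sE EU Yy.
have /choice[ol olP] : forall k, exists ol : G * G,
    [/\ E ol.1, L ol.2 & iter k (bwd f) y = (ol.1 * ol.2)%g].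
  by move=> k; have [e Ee [l Ll el]] := Yy k; exists (e, l).
pose o k := (ol k).1; pose l k := (ol k).2.
have Eo k : E (o k) by case: (olP k).
have Ll k : L (l k) by case: (olP k).
have yE k : iter k (bwd f) y = (o k * l k)%g by case: (olP k).
pose err k := (l k.+1 * (bwd f (l k))^-1)%g.
have oS k : bwd f (o k) = (o k.+1 * err k)%g.
  have : (bwd f (o k) * bwd f (l k) = o k.+1 * l k.+1)%g.
    by rewrite -bwdM -yE -yE.
  by rewrite /err mulgA => <-; rewrite mulgK.
have Lerr k : L (err k).
  by apply: (subgroupM sL (Ll _)); apply: (subgroupV sL); exact: (@Lbwd 1).
have Uerr k : U (err k).
  have -> : err k = ((o k.+1)^-1 * bwd f (o k))%g by rewrite oS mulKg.
  by apply: subgroup_div => //; [case: (EU _ (Eo k.+1))|case: (EU _ (Eo k))].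
pose D k := L `&` (fun z => (o 0%N * z)%g) @^-1` (utrunc f k U).
have main k : exists2 z, D k z & exists c,
    [/\ L c, uplus f U c & iter k (bwd f) (o 0%N * z)%g = (o k * c)%g].
  elim: k => [|k [z [Lz Uz] [c [Lc pc zc]]]].
    exists 1%g.
      split; first exact: subgroup1.
      by move=> i; rewrite leqn0 => /eqP->; rewrite mulg1; case: (EU _ (Eo 0%N)).
    exists 1%g; split; [exact: subgroup1| |by rewrite /= !mulg1].
    by apply: subgroup1; exact: uplus_subgroup.
  have Lm : L (err k * bwd f c)%g.
    by apply: (subgroupM sL (Lerr _)); exact: (@Lbwd 1).
  have Um : U (err k * bwd f c)%g.
    by apply: subgroupM => //; exact: (pc 1%N).
  have [v [Lv pv Lp mp]] := L_factor Lm Um.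
  set p := (v^-1 * _)%g in Lp mp.
  have zS : iter k.+1 (bwd f) (o 0%N * (z * iter k.+1 (fwd f) p^-1))%g = (o k.+1 * v)%g.
    rewrite mulgA biterM fiterK iterS zc bwdM oS.
    have -> : (o k.+1 * err k * bwd f c = o k.+1 * v * p)%g.
      by rewrite /p -!mulgA mulVKg.
    by rewrite mulgK.
  exists (z * iter k.+1 (fwd f) p^-1)%g; last by exists v.
  split; first by apply: (subgroupM sL Lz); apply: Lfwd; exact: (subgroupV sL Lp).
  move=> i; rewrite leq_eqVlt => /predU1P[->|].
    by rewrite zS; apply: subgroupM => //; [case: (EU _ (Eo k.+1))|exact: (pv 0%N)].
  rewrite ltnS => ik; rewrite mulgA biterM; apply: subgroupM => //; first exact: Uz.
  rewrite -(subnKC (leqW ik)) biter_iter fiterV.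
  by apply: (subgroupV sU); exact: mp.
have clD k : closed (D k).
  apply: closedI; first exact: closed_closure.
  have /closed_preim : continuous (fun z : G => (o 0%N * z)%g) by exact: mull_continuous.
  by apply; apply: utrunc_closed; exact: compact_closed.
have [||||z hz] := @compact_decreasing _ D.
- by apply: (subclosed_compact _ cL) => // z [].
- exact: clD.
- by move=> k z [Lz h]; split=> // i ik; apply: h; exact: leqW.
- by move=> k; have [z Dz _] := main k; exists z.
exists (o 0%N * z)%g; first by move=> k; case: (hz k) => _; apply.
have -> : y = (o 0%N * l 0%N)%g by exact: (yE 0%N).
by rewrite invgM -mulgA mulKg; apply: (subgroup_div sL) => //; case: (hz 0%N).
Qed.

Let tidying_subgroup : exists2 Y, compact_open_subgroup Y & L `<=` Y /\
  forall y, uplus f Y y -> exists2 v, uplus f U v & L (v^-1 * y)%g.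
Proof.
have cosW : compact_open_subgroup (U `&` push f 1 U).
  split; first by apply: subgroupI => //; exact: push_subgroup.
    apply: (subclosed_compact _ cU); last by move=> ? [].
    apply: closedI; first exact: compact_closed.
    by apply: compact_closed => //; exact: push_compact.
  by apply: openI => //; exact: push_open.
have [E [cosE EW nE]] := normal_core sL cL cosW.
have [sE cE oE] := cosE.
exists (pmul E L); first exact: pmul_cos.
split; last by move=> y; exact: shadowing.
by move=> l Ll; exists 1%g; [exact: subgroup1|exists l => //; rewrite mul1g].
Qed.

(** The last condition says that the intersection of [U] and [f^n(Y_+)] lies in
    [f^J(Y_+)], with [J] independent of [n]; so it is covered by a number of
    cosets of [Y_+] independent of [n]. *)
Lemma tidying : exists Y J, [/\ compact_open_subgroup Y,
  forall y, uplus f Y y -> exists2 v, uplus f U v & closure (homoclinic f U) (v^-1 * y)%g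
  & forall n x, U x -> push f n (uplus f Y) x -> push f J (uplus f Y) x].
Proof.
have [Y cosY [LY YU]] := tidying_subgroup; have [sY cY oY] := cosY.
have sYp := uplus_subgroup f sY.
have LYp : L `<=` uplus f Y by move=> x Lx n; apply: LY; exact: Lbwd.
(* The [f^-j(U_+)] decrease to a subgroup of [L], hence one of them is in [Y]. *)
have [J hJ] : exists J, forall x, uplus f U x -> uplus f Y (iter J (bwd f) x).
  suff [J hJ] : exists J, forall x, uplus f U (iter J (fwd f) x) -> Y x.
    exists J => x px n; apply: hJ; rewrite -iterD addnC iterD biterK.
    exact: uplus_biter.
  apply: contrapT => nex.
  pose D j := push (tinv f) j (uplus f U) `&` ~` Y.
  have [||||x hx] := @compact_decreasing _ D.
  - apply: (subclosed_compact _ cU); last by move=> x [/uplus_sub].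
    apply: closedI; last exact: open_closedC.
    by apply: uplus_closed; exact: compact_closed.
  - move=> j; apply: closedI; last exact: open_closedC.
    apply: closed_preim; first exact: iter_cont.
    by apply: uplus_closed; exact: compact_closed.
  - move=> j x [px nY]; split=> //; rewrite /push/=.
    by have := uplus_bwd px; rewrite /tinv/= fwdK.
  - move=> j; apply/set0P/negP => /eqP D0; apply: nex; exists j => x px.
    by apply: contrapT => nY; have : D j x by []; rewrite D0.
  have [p0 nYx] := hx 0%N; apply: nYx; apply: LY; apply: fix_homoclinic => //.
  by move=> n; have [/uplus_sub] := hx n.
exists Y, J; split=> // n x Ux Yx.
have [v pv Lv] := YU _ Yx.
set V := iter n (fwd f) v; set l := iter n (fwd f) (v^-1 * iter n (bwd f) x)%g.
have xE : x = (V * l)%g by rewrite /V /l -fiterM mulVKg biterK.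
have Ll : L l by exact: Lfwd.
(* [l] is a limit of homoclinic elements: replacing it by one of them changes
   [x] by an element of both [L] and [U]. *)
have [|l' [hl' Ul']] := Ll (fun y => U (l^-1 * y)%g).
  apply: open_nbhs_nbhs; split; last by rewrite mulVg; exact: subgroup1.
  exact: open_preim (@mull_continuous _ _) oU.
have Ll' : L l' by exact: subset_closure.
have Uxe : U (V * l')%g.
  have -> : (V * l' = x * (l^-1 * l'))%g by rewrite xE -mulgA mulVKg.
  exact: subgroupM.
have [u pu mu] := tidyU Uxe.
have hu : homoclinic f U (u^-1 * (V * l'))%g.
  have [N hN] := hl'; exists (n + N)%N => k nNk; split; first exact: mu.
  rewrite !biterM biterV; apply: (subgroup_div sU); first exact: pu.
  apply: (subgroupM sU); last first.
    by case: (hN k) => //; apply: leq_trans nNk; exact: leq_addl.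
  have nk : (n <= k)%N by apply: leq_trans nNk; exact: leq_addr.
  by rewrite -(subnK nk) iterD fiterK; exact: pv.
have -> : x = (u * ((u^-1 * (V * l')) * (l^-1 * l')^-1))%g.
  by rewrite xE invgM invgK -!mulgA mulVKg mulVKg.
rewrite /push/= biterM; apply: (subgroupM sYp); first exact: hJ.
apply/LYp/Lbwd/(subgroupM sL); first exact: subset_closure.
by apply: (subgroupV sL); exact: (subgroup_div sL).
Qed.

End Growth.

Section ScaleGrowth.
Variable G : topGroupType.
Hypothesis hG : hausdorff_space G.
Implicit Types (f : taut G).

Lemma push_coset_reps f k A B s : coset_reps A B s ->
  coset_reps (push f k A) (push f k B) (map (iter k (fwd f)) s).
Proof.
move=> [us sA sep cs]; split.
- by rewrite map_inj_uniq//; exact: can_inj (fiterK f k).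
- by move=> _ /mapP[y /sA Ay ->]; rewrite /push/= fiterK.
- move=> _ _ /mapP[y ys ->] /mapP[z zs ->].
  by rewrite /push/= biterM biterV !fiterK => /sep ->.
- move=> x /cs[y ys By]; exists (iter k (fwd f) y); first exact: map_f.
  by rewrite /push/= biterM biterV fiterK.
Qed.

Lemma push_iter_reps f P s n : is_subgroup P -> P `<=` push f 1 P ->
  coset_reps (push f 1 P) P s ->
  exists2 r, size r = (size s ^ n)%N & coset_reps (push f n P) P r.
Proof.
move=> sP Psub ps; elim: n => [|n [r sr pr]].
  exists [:: 1%g] => //; split=> //.
  - by move=> y; rewrite inE => /eqP->; exact: subgroup1.
  - by move=> y z; rewrite !inE => /eqP-> /eqP->.
  - by move=> x Px; exists 1%g; rewrite ?inE// invg1 mul1g.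
exists [seq (y * z)%g | y <- map (iter n (fwd f)) s, z <- r].
  by rewrite size_allpairs size_map sr expnS.
apply: (@coset_reps_mul _ _ (push f n P)) => //.
- exact: push_subgroup.
- exact: push_subgroup.
- by rewrite -addn1 pushD => x /Psub.
- move=> x Px; rewrite /push/=; elim: n {r sr pr} => //= n /Psub.
  by rewrite /push/= .
- by rewrite -addn1 pushD; exact: push_coset_reps.
Qed.

(** Let [H] be a closed subgroup containing all the groups [U_+]. Some [t] is an
    upper bound for an index defining the scale of [f], and has its powers
    bounded, up to a constant, by the number of translates of [V] that cover
    [f^n(V)], for every compact subgroup [V] containing a neighbourhood of [1]
    in [H]. Here [t] is the index of [Y_+] in [f(Y_+)], for [Y] as in
    [tidying]. *)
Lemma scale_growth f (Y0 H : set G) : compact_open_subgroup Y0 ->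
  is_subgroup H -> closed H -> (forall x, H x -> H (fwd f x)) ->
  (forall U x, compact_open_subgroup U -> uplus f U x -> H x) ->
  exists t, (exists2 W, compact_open_subgroup W & cov (push f 1 W) W t) /\
    forall V O, is_subgroup V -> compact V -> open O -> O 1%g -> H `&` O `<=` V ->
      exists C, forall n a, cov (push f n V) V a -> (t ^ n <= C * a)%N.
Proof.
move=> cosY0 sH clH Hf HU.
have [U cosU tidyU] := exists_tidy_above hG f cosY0.
have [Y [J [cosY YU UY]]] := tidying hG cosU tidyU.
have [sU cU oU] := cosU; have [sY cY oY] := cosY.
have sP := uplus_subgroup f sY.
have [s ps] := push_uplus_fin_index f cosY.
exists (size s); split; first exact: push_utrunc_cov ps.
have PH : uplus f Y `<=` H.
  move=> y /YU[v pv Lvy]; apply: (subgroup_divK sH (HU _ _ cosU pv)).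
  suff : closure (homoclinic f U) `<=` H by apply.
  rewrite closureE => x; apply; split=> // z [N hN].
  have : H (iter N (bwd f) z).
    apply: (HU U) => // n; rewrite -iterD; case: (hN (n + N)%N) => //.
    exact: leq_addl.
  have iH n w : H w -> H (iter n (fwd f) w) by move=> Hw; elim: n => //= n /Hf.
  by move=> /(iH N); rewrite biterK.
move=> V O sV cV oO O1 OV.
have cP : compact (uplus f Y) by exact: uplus_compact.
have [c1 cov1] : exists c, cov (uplus f Y) V c.
  have [r rP cr] := compact_coset_cover cP oO O1; exists (size r), r => //.
  move=> x Px; have [y yr Oy] := cr x Px; exists y => //; apply: OV.
  by split=> //; apply: subgroup_div => //; apply: PH => //; exact: rP.
have [c3 cov3] := compact_cov cV oU (subgroup1 sU).
exists (c1 * (c3 * size s ^ J))%N => n a cova.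
have Psub : uplus f Y `<=` push f 1 (uplus f Y) by move=> x; exact: uplus_bwd.
have [r <- pr] := push_iter_reps n sP Psub ps.
have sPn := push_subgroup f n sP.
have cov2 : cov (push f n (uplus f Y)) V (c1 * a).
  by apply: cov_trans cova; exact: push_cov.
have {}cov2 := cov_setI sV sPn cov2; rewrite setIid in cov2.
have {}cov3 := cov_setI sU sPn cov3.
have cov4 : cov (U `&` push f n (uplus f Y)) (uplus f Y) (size s ^ J).
  apply: (@cov_sub _ (push f J (uplus f Y)) (uplus f Y)) => //.
    by move=> x [Ux]; exact: UY.
  by apply: cov_iter; exact: coset_reps_cov.
have [q qs cq] := cov_trans cov2 (cov_trans cov3 cov4).
apply: leq_trans (coset_reps_le_cover sP pr cq) _.
by apply: leq_trans qs _; rewrite -mulnA [(a * _)%N]mulnC mulnA.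
Qed.

End ScaleGrowth.

(** * Existence of compact open subgroups *)

Section QuasiComponent.
Variables (T : topologicalType) (K K2 : set T) (x : T).
Hypotheses (hT : hausdorff_space T) (cK : compact K) (cK2 : compact K2).
Hypotheses (KK2 : K `<=` K2°) (Kx : K x).

(** The relatively clopen subsets of [K] containing [x]. *)
Let rel_clopen : set (set T) :=
  [set A | [/\ A `<=` K, closed A, closed (K `\` A) & A x]].

(** The quasi-component of [x] in [K]. *)
Let C := \bigcap_(A in rel_clopen) A.

Let clK : closed K. Proof. exact: compact_closed. Qed.

Let rel_clopenK : rel_clopen K.
Proof. by split=> //; rewrite setDv; exact: closed0. Qed.

Let rel_clopenI A B : rel_clopen A -> rel_clopen B -> rel_clopen (A `&` B).
Proof.
move=> [AK clA clA' Ax] [BK clB clB' Bx]; split=> //.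
- by move=> y [/AK].
- exact: closedI.
- by rewrite setDIr; exact: closedU.
Qed.

Let CK : C `<=` K. Proof. by move=> y; apply. Qed.

Let avoid Z : closed Z -> Z `<=` K -> C `&` Z = set0 ->
  exists2 A, rel_clopen A & A `&` Z = set0.
Proof.
move=> clZ ZK CZ; apply: contrapT => nex.
pose F := filter_from rel_clopen (fun A => A `&` Z).
have FF : ProperFilter F.
  apply: filter_from_proper.
    apply: filter_from_filter; first by exists K.
    move=> A B rA rB; exists (A `&` B); first exact: rel_clopenI.
    by move=> y [[? ?] ?].
  move=> A rA; apply/set0P/negP => /eqP AZ; apply: nex; exists A => //.
have cZ : compact Z by exact: subclosed_compact clZ cK ZK.
have [|p [Zp clp]] := cZ F FF; first by exists K => // y [].
suff : (C `&` Z) p by rewrite CZ.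
split=> // A rA; have [_ clA _ _] := rA; apply: clA.
move: clp; rewrite clusterE => /(_ A); apply.
by exists A => // y [].
Qed.

(** Disjoint closed parts of the quasi-component [C] have disjoint open
    neighbourhoods, which cover a relatively clopen set containing [x]; the part
    not containing [x] is then separated from [x]. *)
Let component_part P Q : closed P -> closed Q -> P `|` Q = C -> P `&` Q = set0 ->
  P x -> Q = set0.
Proof.
move=> clP clQ PQC PQ Px; have PC : P `<=` C by rewrite -PQC => y; left.
have QC : Q `<=` C by rewrite -PQC => y; right.
have nQ : set_nbhs P (~` Q).
  move=> y Py; apply: open_nbhs_nbhs; split; first exact: closed_openC.
  by move=> Qy; suff : (P `&` Q) y by rewrite PQ.
have [W PW WQ] :=
  compact_normal_local hT cK2 (fun y Py => KK2 (CK (PC y Py))) clP nQ.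
have /set_nbhsP[D [oD PD DW]] := PW.
have DQ y : closure D y -> ~ Q y by move=> /(closureS DW)/WQ.
have [] := @avoid (K `&` (~` D `&` closure D)).
- apply: closedI => //; apply: closedI; last exact: closed_closure.
  exact: open_closedC.
- by move=> y [].
- rewrite -subset0 => y [Cy [Ky [nDy cDy]]].
  by move: Cy; rewrite -PQC => -[/PD//|/(DQ _ cDy)].
move=> A rA AZ; have [AK clA clA' Ax] := rA.
have rA' : rel_clopen (A `&` closure D).
  split.
  - by move=> y [/AK].
  - by apply: closedI => //; exact: closed_closure.
  - rewrite (_ : _ `\` _ = (K `\` A) `|` (K `&` ~` D)).
      by apply: closedU => //; apply: closedI => //; exact: open_closedC.
    apply/seteqP; split=> y.
      move=> [Ky nAD]; have [Ay|nAy] := pselect (A y); last by left.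
      by right; split=> // Dy; apply: nAD; split=> //; exact: subset_closure.
    move=> [[Ky nAy]|[Ky nDy]]; split=> // -[Ay cDy] //.
    by suff : (A `&` (K `&` (~` D `&` closure D))) y by rewrite AZ.
  - by split=> //; apply/subset_closure/PD.
rewrite -subset0 => y Qy; have [_ cDy] := QC _ Qy _ rA'.
exact: DQ Qy.
Qed.

(** In a compact set the quasi-component of a point is connected; so, in a
    totally disconnected space, a point is separated from a closed set not
    containing it by a relatively clopen set. *)
Lemma relatively_clopen_separation (B : set T) : totally_disconnected [set: T] ->
  closed B -> B `<=` K -> ~ B x ->
  exists A, [/\ A `<=` K, closed A, closed (K `\` A), A x & A `&` B = set0].
Proof.
move=> tdT clB BK nBx.
have clC : closed C by apply: closed_bigI => A [].
have Cx : C x by move=> A [].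
have connC : connected C.
  move=> P P0 [D oD PE] [F clF PE'].
  have clP : closed P by rewrite PE'; exact: closedI.
  have clQ : closed (C `&` ~` D) by apply: closedI => //; exact: open_closedC.
  have PQ : P `|` (C `&` ~` D) = C by rewrite PE -setIUr setUv setIT.
  have PQ0 : P `&` (C `&` ~` D) = set0.
    by rewrite PE setIACA setICr setI0.
  have [Px|nPx] := pselect (P x).
    by have := component_part clP clQ PQ PQ0 Px => Q0; rewrite -PQ Q0 setU0.
  have Qx : (C `&` ~` D) x by split=> // Dx; apply: nPx; rewrite PE.
  rewrite setUC in PQ; rewrite setIC in PQ0.
  have P0' := component_part clQ clP PQ PQ0 Qx.
  by have [y] := P0; rewrite P0'.
have CE y : C y -> y = x.
  move=> Cy; suff : [set x] y by [].
  have <- : connected_component setT x = [set x] by exact: tdT.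
  by exists C.
have [|A [AK clA clA' Ax] AB] := avoid clB BK; last by exists A.
by rewrite -subset0 => y [/CE->].
Qed.

End QuasiComponent.

(** Van Dantzig's theorem. *)
Lemma exists_compact_open_subgroup (G : topGroupType) : tdlc G ->
  exists U : set G, compact_open_subgroup U.
Proof.
move=> [hG lcG tdG].
have [K K1 [cK clK]] := lcG 1%g I; rewrite withinET in K1.
have KK2 : K `<=` (pmul K K)°.
  move=> k Kk.
  have : nbhs k (fun y => K (k^-1 * y)%g).
    by apply: (@mull_continuous G (k^-1)%g k); rewrite mulVg.
  by apply: filterS => y Ky; exists k => //; exists (k^-1 * y)%g => //; rewrite mulVKg.
have cK2 := compact_pmul cK cK.
have K1' : K 1%g by exact: nbhs_singleton.
have [|||A [AK clA clKA A1 AB]] :=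
    relatively_clopen_separation hG cK cK2 KK2 K1' (B := K `\` K°) tdG.
- by rewrite setDE; apply: closedI => //; apply: open_closedC; exact: open_interior.
- by move=> x [].
- by move=> [_]; apply.
have oA : open A.
  rewrite (_ : A = K° `&` ~` (K `\` A)).
    by apply: openI; [exact: open_interior|exact: closed_openC].
  apply/seteqP; split=> x.
    move=> Ax; split; last by move=> [_].
    apply: contrapT => nKx; suff : (A `&` (K `\` K°)) x by rewrite AB.
    by split=> //; split=> //; exact: AK.
  by move=> [/interior_subset Kx nKA]; apply: contrapT => nAx; apply: nKA.
have cA : compact A by exact: subclosed_compact clA cK AK.
(* The stabilizer of [A] under left translations; it is contained in [A]
   since [A] contains [1]. *)
pose U := [set x | forall k, A k -> A (x * k)%g /\ A (x^-1 * k)%g].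
have sU : is_subgroup U.
  split.
  - by move=> k Ak; rewrite invg1 !mul1g.
  - move=> x y hx hy k Ak; rewrite invgM -!mulgA.
    by split; [apply/(proj1 (hx _ _))/(proj1 (hy _ _))|apply/(proj2 (hy _ _))/(proj2 (hx _ _))].
  - by move=> x hx k Ak; rewrite invgK; case: (hx k Ak).
have nU : nbhs 1%g [set x : G | A `<=` [set k | A (x * k)%g]].
  have nc := iffLR (compact_near_coveringP A) cA.
  have {nc} := nc G (nbhs (1%g : G)) (fun x k => A (x * k)%g) (nbhs_filter _).
  apply => k Ak.
  have ct : {for (k, 1%g : G), continuous (fun p : G * G => (p.2 * p.1)%g)}.
    apply: (@continuous_comp _ _ _ (fun p : G * G => (p.2, p.1))
      (fun p : G * G => (p.1 * p.2)%g)); last exact: mulg_continuous.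
    by apply: cvg_pair; [exact: cvg_snd|exact: cvg_fst].
  by apply: ct; rewrite /= mul1g; exact: open_nbhs_nbhs.
have nU' : nbhs 1%g [set x : G | A `<=` [set k | A (x^-1 * k)%g]].
  have ci : {for 1%g, continuous (fun x : G => x^-1)%g} by exact: invg_continuous.
  have := ci [set x : G | A `<=` [set k | A (x * k)%g]].
  by rewrite invg1; apply.
have n1U : nbhs 1%g U.
  by apply: filterS (filterI nU nU') => x [h h'] k Ak; split; [exact: h|exact: h'].
have oU : open U.
  apply: (@open_subgroup _ _ U°) => //; first exact: open_interior.
  exact: interior_subset.
exists U; split=> //.
apply: (@subclosed_compact _ U A) => //; first exact: open_subgroup_closed.
by move=> x /(_ 1%g A1)[]; rewrite mulg1.
Qed.

(** * Fellow travelling in NPC spaces *)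

Section Geodesics.
Variables (R : realType) (X : metricType R).
Implicit Types (p q r x y z : X) (sigma tau gamma : R -> X).

Lemma geodesic_dist p q sigma s t : geodesic p q sigma ->
  0 <= s -> s <= t -> t <= mdist p q -> mdist (sigma s) (sigma t) = t - s.
Proof.
move=> [_ _ g] s0 st tq; rewrite g; last 2 first.
- by rewrite s0 (le_trans st).
- by rewrite (le_trans s0 st).
by rewrite distrC ger0_norm// subr_ge0.
Qed.

Lemma geodesic_start p q sigma t : geodesic p q sigma ->
  0 <= t -> t <= mdist p q -> mdist p (sigma t) = t.
Proof.
move=> g t0 tq; have [s0 _ _] := g.
by rewrite -{1}s0 (geodesic_dist g)// subr0.
Qed.

Lemma geodesic_end p q sigma t : geodesic p q sigma ->
  0 <= t -> t <= mdist p q -> mdist (sigma t) q = mdist p q - t.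
Proof.
move=> g t0 tq; have [_ s1 _] := g.
by rewrite -{1}s1 (geodesic_dist g).
Qed.

Lemma geodesic_rev p q sigma : geodesic p q sigma ->
  geodesic q p (fun s => sigma (mdist p q - s)).
Proof.
move=> [s0 s1 g]; rewrite /geodesic (metric_sym q p); split.
- by rewrite subr0.
- by rewrite subrr.
- move=> s t /andP[? ?] /andP[? ?]; rewrite g; last 2 first.
  + by apply/andP; split; lra.
  + by apply/andP; split; lra.
  by rewrite distrC; congr (`|_|); ring.
Qed.

Lemma ray_dist gamma s t : geodesic_ray gamma -> 0 <= s -> s <= t ->
  mdist (gamma s) (gamma t) = t - s.
Proof.
move=> g s0 st; rewrite g ?(le_trans s0 st)//.
by rewrite distrC ger0_norm// subr_ge0.
Qed.

Lemma ray_geodesic gamma t : geodesic_ray gamma -> 0 <= t ->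
  geodesic (gamma 0) (gamma t) gamma.
Proof.
move=> g t0; rewrite /geodesic (ray_dist g)// subr0; split=> // s u /andP[? _] /andP[? _].
exact: g.
Qed.

(** The two ways in which the geodesics issued from a common point stay close,
    in both kinds of NPC spaces: at any time, within a multiple of the distance
    of the endpoints; at a given time, within the constant [K] when they are
    long enough and their endpoints at bounded distance. *)
Definition fellow_travel (K : R) :=
  [/\ 0 <= K,
      (forall p q r sigma tau t, geodesic p q sigma -> geodesic p r tau ->
         0 <= t -> t <= mdist p q -> t <= mdist p r ->
         mdist (sigma t) (tau t) <= 4 * mdist q r + K)
    & forall c t, exists a, forall p q r sigma tau,
         geodesic p q sigma -> geodesic p r tau ->
         mdist q r <= c -> a <= mdist p q ->
         0 <= t -> t <= mdist p q -> t <= mdist p r ->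
         mdist (sigma t) (tau t) <= K].

Let sqrt_eq (x y : R) : 0 <= y -> x = y ^+ 2 -> Num.sqrt x = y.
Proof. by move=> y0 ->; rewrite sqrtr_sqr ger0_norm. Qed.

(** In a Euclidean triangle with sides [a], [b] issued from the same vertex and
    third side [c], the points at distance [t] from that vertex are at squared
    distance [t^2 (c^2 - (a - b)^2) / (a b)]. *)
Lemma CAT0_estimate p q r sigma tau t : CAT0 X ->
  geodesic p q sigma -> geodesic p r tau ->
  0 <= t -> t <= mdist p q -> t <= mdist p r ->
  mdist p q * mdist p r * mdist (sigma t) (tau t) ^+ 2 <= t ^+ 2 * mdist q r ^+ 2.
Proof.
move=> cat g1 g2 t0 tq tr.
have R0 : 0 <= t ^+ 2 * mdist q r ^+ 2 by rewrite mulr_ge0// sqr_ge0.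
set a := mdist p q in tq *; set b := mdist p r in tr *; set c := mdist q r in R0 *.
have [a0|a0] := eqVneq a 0; first by rewrite a0 !mul0r.
have [b0|b0] := eqVneq b 0; first by rewrite b0 mulr0 !mul0r.
have ap : 0 < a by rewrite lt_neqAle eq_sym a0 mdist_ge0.
have bp : 0 < b by rewrite lt_neqAle eq_sym b0 mdist_ge0.
have c0 : 0 <= c by exact: mdist_ge0.
have t1 : a <= b + c by rewrite /a (le_trans (metric_triangle _ r _))// (metric_sym r q).
have t2 : b <= a + c by exact: metric_triangle.
have t3 : c <= a + b by rewrite /c (le_trans (metric_triangle _ p _))// (metric_sym q p).
have [x xE] : exists x : R, 2 * a * x = a ^+ 2 + b ^+ 2 - c ^+ 2.
  exists ((a ^+ 2 + b ^+ 2 - c ^+ 2) / (2 * a)).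
  by rewrite mulrC divfK// mulf_neq0// pnatr_eq0.
have y2 : 0 <= b ^+ 2 - x ^+ 2.
  have : 0 <= (2 * a) ^+ 2 * (b ^+ 2 - x ^+ 2).
    rewrite mulrBr -exprMn -exprMn xE subr_sqr mulr_ge0//.
      have : 0 <= (c - (a - b)) * (c + (a - b)) by apply: mulr_ge0; lra.
      by nra.
    have : 0 <= (a + b - c) * (a + b + c) by apply: mulr_ge0; lra.
    by nra.
  by rewrite pmulr_rge0// exprn_gt0// mulr_gt0.
have [y yE] : exists y : R, y ^+ 2 = b ^+ 2 - x ^+ 2.
  by exists (Num.sqrt (b ^+ 2 - x ^+ 2)); rewrite sqr_sqrtr.
have [k kb] : exists k : R, k * b = t by exists (t / b); rewrite divfK.
have := cat p q r sigma tau g1 g2 (0, 0) (a, 0) (x, y) _ _ _ t t _ _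
  (t, 0) (k * x, k * y) _ _.
have E1 : eucl_dist (0, 0) (a, 0) = mdist p q.
  by apply: sqrt_eq => /=; [exact: ltW|rewrite -/a; ring].
have E2 : eucl_dist (0, 0) (x, y) = mdist p r.
  by apply: sqrt_eq => /=; [exact: ltW|rewrite !sub0r !sqrrN yE; rewrite -/b; ring].
have E3 : eucl_dist (a, 0) (x, y) = mdist q r.
  apply: sqrt_eq => //=; rewrite sub0r sqrrN yE -/c.
  have -> : (a - x) ^+ 2 = a ^+ 2 - 2 * a * x + x ^+ 2 by ring.
  by rewrite xE; ring.
have E4 : comparison_point p q (sigma t) (0, 0) (a, 0) (t, 0).
  split.
    rewrite (geodesic_start g1)//; apply: sqrt_eq => //=; ring.
  rewrite (geodesic_end g1)//; apply: sqrt_eq => /=; first by rewrite subr_ge0.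
  by rewrite -/a; ring.
have E5 : comparison_point p r (tau t) (0, 0) (x, y) (k * x, k * y).
  split.
    rewrite (geodesic_start g2)//; apply: sqrt_eq => //=.
    rewrite !sub0r !sqrrN !exprMn yE -[in RHS]kb exprMn; ring.
  rewrite (geodesic_end g2)//; apply: sqrt_eq => /=; first by rewrite subr_ge0.
  have -> : (k * x - x) ^+ 2 + (k * y - y) ^+ 2 = (k - 1) ^+ 2 * (x ^+ 2 + y ^+ 2) by ring.
  by rewrite yE -/b -[in RHS]kb; ring.
move=> /(_ E1 E2 E3); rewrite t0 tq tr => /(_ isT isT E4 E5).
set d := mdist _ _; move=> dE.
have d0 : 0 <= d by exact: mdist_ge0.
have d2 : d ^+ 2 <= (t - k * x) ^+ 2 + (k * y) ^+ 2.
  have -> : (t - k * x) ^+ 2 + (k * y) ^+ 2 = (eucl_dist (t, 0) (k * x, k * y)) ^+ 2.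
    rewrite sqr_sqrtr/=; first by rewrite sub0r sqrrN.
    by rewrite addr_ge0// sqr_ge0.
  by rewrite lerXn2r// nnegrE// (le_trans d0).
have E : a * b * ((t - k * x) ^+ 2 + (k * y) ^+ 2) = t ^+ 2 * (c ^+ 2 - (a - b) ^+ 2).
  rewrite [X in a * b * X](_ : _ = t ^+ 2 - 2 * t * k * x + k ^+ 2 * b ^+ 2); last first.
    by rewrite !exprMn yE; ring.
  rewrite (_ : a * b * _ = a * b * t ^+ 2 - t * (k * b) * (2 * a * x) + (k * b) ^+ 2 * (a * b)).
    by rewrite kb xE; ring.
  by ring.
apply: (@le_trans _ _ (a * b * ((t - k * x) ^+ 2 + (k * y) ^+ 2))).
  by rewrite ler_wpM2l// mulr_ge0// ltW.
rewrite E ler_wpM2l ?sqr_ge0// gerBl; exact: sqr_ge0.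
Qed.

Lemma CAT0_fellow_travel : CAT0 X -> fellow_travel 1.
Proof.
move=> cat; split=> //.
  move=> p q r sigma tau t g1 g2 t0 tq tr.
  have := CAT0_estimate cat g1 g2 t0 tq tr.
  have c0 := mdist_ge0 q r; have d0 := mdist_ge0 (sigma t) (tau t).
  have [->|tn0] := eqVneq t 0.
    have [-> _ _] := g1; have [-> _ _] := g2; rewrite mdistxx => _; lra.
  have tp : 0 < t by rewrite lt_neqAle eq_sym tn0.
  move=> h; suff : mdist (sigma t) (tau t) <= mdist q r by lra.
  rewrite -(@ler_pXn2r _ 2)// ?nnegrE//.
  have : t ^+ 2 * mdist (sigma t) (tau t) ^+ 2 <= t ^+ 2 * mdist q r ^+ 2.
    apply: le_trans h; rewrite ler_wpM2r ?sqr_ge0//.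
    by rewrite expr2 ler_pM.
  by rewrite ler_pM2l// exprn_gt0.
move=> c t; exists (c + 1 + t ^+ 2 * c ^+ 2) => p q r sigma tau g1 g2 qr pq t0 tq tr.
have h := CAT0_estimate cat g1 g2 t0 tq tr.
have c0 := mdist_ge0 q r; have d0 := mdist_ge0 (sigma t) (tau t).
have t1 : mdist p q <= mdist p r + mdist q r.
  by rewrite (le_trans (metric_triangle _ r _))// (metric_sym r q).
set e := t ^+ 2 * c ^+ 2 in pq.
have e0 : 0 <= e by rewrite mulr_ge0// sqr_ge0.
have he : t ^+ 2 * mdist q r ^+ 2 <= e.
  by rewrite ler_wpM2l ?sqr_ge0// lerXn2r// nnegrE// (le_trans c0).
have ab : e + 1 <= mdist p q * mdist p r.
  have h1 : 1 <= mdist p q by lra.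
  have h2 : e + 1 <= mdist p r by lra.
  by apply: le_trans h2 _; rewrite ler_peMl// mdist_ge0.
rewrite leNgt; apply/negP => d1.
have : (e + 1) * 1 <= mdist p q * mdist p r * mdist (sigma t) (tau t) ^+ 2.
  by apply: ler_pM => //; [lra|rewrite expr_ge1// ltW].
lra.
Qed.

End Geodesics.

(** * Hyperbolic spaces *)

Section Hyperbolic.
Variables (R : realType) (X : metricType R) (delta : R).
Hypotheses (gX : geodesic_space X) (delta0 : 0 <= delta).
Hypothesis thin : thin_triangles X delta.
Implicit Types (p q r x y z : X) (sigma tau gamma : R -> X).

(** Two geodesics issued from [p] stay uniformly close up to the time given by
    the Gromov product of their endpoints. *)
Lemma gromov_product_fellow p q r sigma tau t :
  geodesic p q sigma -> geodesic p r tau -> 0 <= t -> t <= gromov_product p q r ->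
  mdist (sigma t) (tau t) <= 4 * delta + 2.
Proof.
move=> g1 g2 t0; rewrite /gromov_product => tg.
have d0 := delta0; have [rho g3] := gX q r.
have t1 : mdist p q <= mdist p r + mdist q r.
  by rewrite (le_trans (metric_triangle _ r _))// (metric_sym r q).
have t2 : mdist p r <= mdist p q + mdist q r by exact: metric_triangle.
have tq : t <= mdist p q by lra.
have tr : t <= mdist p r by lra.
have key s : 0 <= s -> s < (mdist p q + mdist p r - mdist q r) / 2 - delta ->
    mdist (sigma s) (tau s) <= 2 * delta.
  move=> s0 sg; have sq : s <= mdist p q by lra.
  have sr : s <= mdist p r by lra.
  have [|[u /andP[u0 u1] su]|[u /andP[u0 u1] su]] := thin g1 g3 g2 (s := s); first by rewrite s0.
    have a1 := geodesic_start g1 s0 sq.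
    have a2 := metric_triangle p (sigma s) (rho u).
    have a3 := metric_triangle p (rho u) q.
    have a4 := metric_triangle p (rho u) r.
    have a5 := geodesic_start g3 u0 u1; have a6 := geodesic_end g3 u0 u1.
    rewrite (metric_sym (rho u) q) in a3; lra.
  have a1 := geodesic_start g1 s0 sq; have a2 := geodesic_start g2 u0 u1.
  have a3 := metric_triangle p (sigma s) (tau u).
  have a4 := metric_triangle p (tau u) (sigma s).
  rewrite (metric_sym (tau u)) in a4.
  have a5 := metric_triangle (sigma s) (tau u) (tau s).
  have [su'|us'] := leP s u.
    have := geodesic_dist g2 s0 su' u1; rewrite metric_sym => a6; lra.
  have := geodesic_dist g2 u0 (ltW us') sr => a6; lra.
have [ts|ts] := leP (delta + 1) t.
  pose s := t - delta - 1.
  have s0 : 0 <= s by rewrite /s; lra.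
  have st : s <= t by rewrite /s; lra.
  have ks : mdist (sigma s) (tau s) <= 2 * delta by apply: key => //; rewrite /s; lra.
  have a1 := geodesic_dist g1 s0 st tq; have a2 := geodesic_dist g2 s0 st tr.
  have a3 := metric_triangle (sigma t) (sigma s) (tau t).
  have a4 := metric_triangle (sigma s) (tau s) (tau t).
  rewrite (metric_sym (sigma t) (sigma s)) in a3; rewrite /s in a1 a2 ks *; lra.
have a1 := geodesic_start g1 t0 tq; have a2 := geodesic_start g2 t0 tr.
have a3 := metric_triangle (sigma t) p (tau t).
rewrite (metric_sym (sigma t) p) in a3; lra.
Qed.

Lemma hyperbolic_fellow_travel : fellow_travel X (4 * delta + 2).
Proof.
have d0 := delta0; split; first lra.
  move=> p q r sigma tau t g1 g2 t0 tq tr.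
  have t1 : mdist p q <= mdist p r + mdist q r.
    by rewrite (le_trans (metric_triangle _ r _))// (metric_sym r q).
  have t2 : mdist p r <= mdist p q + mdist q r by exact: metric_triangle.
  have qr0 := mdist_ge0 q r.
  have [tg|tg] := leP t (gromov_product p q r).
    by apply: le_trans (gromov_product_fellow g1 g2 t0 tg) _; lra.
  rewrite /gromov_product in tg.
  have a1 := geodesic_end g1 t0 tq; have a2 := geodesic_end g2 t0 tr.
  have a3 := metric_triangle (sigma t) q (tau t).
  have a4 := metric_triangle q r (tau t).
  rewrite (metric_sym r (tau t)) in a4; lra.
move=> c t; exists (t + c) => p q r sigma tau g1 g2 qr pq t0 tq tr.
apply: (gromov_product_fellow g1 g2 t0); rewrite /gromov_product.
have t1 : mdist p q <= mdist p r + mdist q r.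
  by rewrite (le_trans (metric_triangle _ r _))// (metric_sym r q).
lra.
Qed.

(** Gromov's four-point condition. *)
Lemma four_point p x y z :
  mdist x z + mdist p y <= mdist p z + mdist x y + 2 * (4 * delta + 2) \/
  mdist x z + mdist p y <= mdist p x + mdist y z + 2 * (4 * delta + 2).
Proof.
have d0 := delta0; have [sx gx] := gX p x; have [sy gy] := gX p y; have [sz gz] := gX p z.
have close t : 0 <= t -> t <= gromov_product p x y -> t <= gromov_product p y z ->
    mdist x z <= mdist p x + mdist p z + 2 * (4 * delta + 2) - 2 * t.
  move=> t0 txy tyz.
  have a1 := gromov_product_fellow gx gy t0 txy.
  have a2 := gromov_product_fellow gy gz t0 tyz.
  rewrite /gromov_product in txy tyz.
  have b1 := metric_triangle p y x; have b2 := metric_triangle p y z.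
  rewrite (metric_sym y x) in b1.
  have b3 := metric_triangle p x y; have b4 := metric_triangle p z y.
  rewrite (metric_sym z y) in b4.
  have a3 : mdist (sx t) x = mdist p x - t by apply: geodesic_end gx _ _ => //; lra.
  have a4 : mdist (sz t) z = mdist p z - t by apply: geodesic_end gz _ _ => //; lra.
  have c1 := metric_triangle x (sx t) z; have c2 := metric_triangle (sx t) (sz t) z.
  have c3 := metric_triangle (sx t) (sy t) (sz t).
  rewrite (metric_sym x (sx t)) in c1; lra.
have g0 q r : 0 <= gromov_product p q r.
  rewrite /gromov_product divr_ge0// subr_ge0 (metric_sym p q).
  exact: metric_triangle.
have [h|h] := leP (gromov_product p x y) (gromov_product p y z).
  left; have := close _ (g0 x y) (lexx _) h.
  by rewrite /gromov_product; lra.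
right; have := close _ (g0 y z) (ltW h) (lexx _).
by rewrite /gromov_product; lra.
Qed.

End Hyperbolic.

(** * Convergence to the boundary, and asymptotic rays *)

(** Convergence to the boundary point, up to the error [K]: the geodesics from
    the origin of a ray to the terms of the sequence converge to that ray. *)
Definition coarse_cvg (R : realType) (X : metricType R) (K : R) (u : nat -> X)
    (xi : boundary X) : Prop :=
  forall gamma, boundary_class xi gamma -> forall r, 0 < r ->
  exists N, forall n, (N <= n)%N -> r < mdist (gamma 0) (u n) /\
    forall sigma, geodesic (gamma 0) (u n) sigma -> mdist (sigma r) (gamma r) <= K.

Lemma boundary_ray (R : realType) (X : metricType R) (xi : boundary X) gamma :
  boundary_class xi gamma -> geodesic_ray gamma.
Proof. by have [rho _ ->] := boundaryP xi => -[]. Qed.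

(** Both notions of convergence to the boundary imply the coarse one. *)
Lemma npc_coarse (R : realType) (c : npc_case) (X : metricType R) :
  npc_space c X -> exists2 K, fellow_travel X K &
    forall (u : nat -> X) xi, cvg_boundary c u xi -> coarse_cvg K u xi.
Proof.
case: c => -[gX]; last first.
  move=> [_ [delta d0 thin]]; exists (4 * delta + 2).
    exact: hyperbolic_fellow_travel.
  move=> u xi cu gamma xig r r0.
  have [N hN] := cu _ xig (gamma 0) (r + 1).
  have rg := boundary_ray xig.
  exists N => n Nn.
  pose j := maxn N (Num.truncn r).+1.
  have jr : r <= j%:R.
    apply: (@le_trans _ _ (Num.truncn r).+1%:R); last by rewrite ler_nat leq_maxr.
    exact/ltW/truncnS_gt.
  have j0 : 0 <= (j%:R : R) by lra.
  have := hN n j Nn (leq_maxl _ _) => g.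
  have g2 := ray_geodesic rg j0.
  have gle : gromov_product (gamma 0) (u n) (gamma j%:R) <= mdist (gamma 0) (u n).
    rewrite /gromov_product.
    by have := metric_triangle (gamma 0) (u n) (gamma j%:R); lra.
  split; first lra.
  move=> sigma g1; apply: (gromov_product_fellow gX d0 thin g1 g2); lra.
move=> [_ cat]; exists 1; first exact: CAT0_fellow_travel.
move=> u xi cu gamma xig r r0; have [N _ hN] := cu _ xig r 1 r0 ltr01.
by exists N => n Nn; have [h1 h2] := hN n Nn; split=> // sigma /h2/ltW.
Qed.

Section Rays.
Variables (R : realType) (X : metricType R) (K : R).
Hypotheses (gX : geodesic_space X) (ftX : fellow_travel X K).
Implicit Types (p q r x y z : X) (sigma tau gamma : R -> X).

Lemma fellow_common_end p1 p2 q sigma tau t :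
  geodesic p1 q sigma -> geodesic p2 q tau ->
  0 <= t -> t <= mdist p1 q -> t <= mdist p2 q ->
  mdist (sigma t) (tau t) <= 5 * mdist p1 p2 + K.
Proof.
wlog ab : p1 p2 sigma tau / mdist p2 q <= mdist p1 q.
  move=> hw g1 g2 t0 t1 t2; have [ab|/ltW ab] := leP (mdist p2 q) (mdist p1 q).
    exact: hw.
  by rewrite metric_sym (metric_sym p1); exact: hw.
move=> g1 g2 t0 t1 t2; have [_ ft _] := ftX.
have tri : mdist p1 q <= mdist p1 p2 + mdist p2 q by exact: metric_triangle.
pose s := mdist p2 q - t.
have := ft _ _ _ _ _ s (geodesic_rev g1) (geodesic_rev g2).
rewrite (metric_sym q p1) (metric_sym q p2) /s.
have -> : mdist p2 q - (mdist p2 q - t) = t by ring.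
set t' := mdist p1 q - (mdist p2 q - t).
move=> h; have {}h : mdist (sigma t') (tau t) <= 4 * mdist p1 p2 + K.
  by apply: h; lra.
have tt' : t <= t' by rewrite /t'; lra.
have := geodesic_dist g1 t0 tt' _; rewrite /t' => d1.
have {}d1 : mdist (sigma t) (sigma t') = t' - t by apply: d1; lra.
have := metric_triangle (sigma t) (sigma t') (tau t); rewrite d1 /t' => h'.
rewrite /t' in h; lra.
Qed.

(** The bound depends only on the initial distance and on the space. *)
Lemma asymptotic_bound gamma1 gamma2 t : geodesic_ray gamma1 -> geodesic_ray gamma2 ->
  asymptotic gamma1 gamma2 -> 0 <= t ->
  mdist (gamma1 t) (gamma2 t) <= 5 * mdist (gamma1 0) (gamma2 0) + 2 * K.
Proof.
move=> r1 r2 [C hC] t0; have [K0 _ ft] := ftX.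
have [b hb] := ft C t.
pose T := `|b| + t + `|C|.
have Tt : t <= T by rewrite /T; have := normr_ge0 b; have := normr_ge0 C; lra.
have T0 : 0 <= T by lra.
have bT : b <= T by rewrite /T; have := ler_norm b; have := normr_ge0 C; lra.
have CT : t + C <= T by rewrite /T; have := ler_norm C; have := normr_ge0 b; lra.
have [rho g3] := gX (gamma1 0) (gamma2 T).
have g1 := ray_geodesic r1 T0; have g2 := ray_geodesic r2 T0.
have d1 : mdist (gamma1 0) (gamma1 T) = T by rewrite (ray_dist r1)// subr0.
have d2 : mdist (gamma2 0) (gamma2 T) = T by rewrite (ray_dist r2)// subr0.
have hT := hC T T0.
have d3 : t <= mdist (gamma1 0) (gamma2 T).
  have := metric_triangle (gamma1 0) (gamma2 T) (gamma1 T).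
  by rewrite d1 (metric_sym (gamma2 T)); lra.
have a1 : mdist (gamma1 t) (rho t) <= K.
  by apply: (hb _ _ _ _ _ g1 g3) => //; rewrite d1.
have a2 : mdist (rho t) (gamma2 t) <= 5 * mdist (gamma1 0) (gamma2 0) + K.
  by apply: (fellow_common_end g3 g2) => //; rewrite d2.
by have := metric_triangle (gamma1 t) (rho t) (gamma2 t); lra.
Qed.

Lemma asymptotic_sym gamma1 gamma2 : asymptotic gamma1 gamma2 -> asymptotic gamma2 gamma1.
Proof. by move=> [C hC]; exists C => t t0; rewrite metric_sym; exact: hC. Qed.

Lemma asymptotic_trans gamma1 gamma2 gamma3 :
  asymptotic gamma1 gamma2 -> asymptotic gamma2 gamma3 -> asymptotic gamma1 gamma3.
Proof.
move=> [C hC] [C' hC']; exists (C + C') => t t0.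
by rewrite (le_trans (metric_triangle _ (gamma2 t) _))// lerD ?hC ?hC'.
Qed.

(** If [u] converges to the class of [gamma1], and the geodesics from the origin
    of [gamma2] to the terms of a sequence at bounded distance from [u] converge
    to [gamma2], then the two rays are asymptotic. *)
Lemma coarse_cvg_close u v xi gamma1 gamma2 C :
  coarse_cvg K u xi -> boundary_class xi gamma1 ->
  (forall n, mdist (u n) (v n) <= C) ->
  (forall t, 0 < t -> exists N, forall n, (N <= n)%N -> forall sigma,
     geodesic (gamma2 0) (v n) sigma -> mdist (sigma t) (gamma2 t) <= K) ->
  asymptotic gamma1 gamma2.
Proof.
move=> cu xi1 uv h2; have [K0 _ ft] := ftX.
have A0 := mdist_ge0 (gamma1 0) (gamma2 0).
exists (5 * mdist (gamma1 0) (gamma2 0) + 4 * K) => t.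
rewrite le_eqVlt => /predU1P[<-|t0]; first lra.
have [b hb] := ft C t; have [N1 hN1] := cu _ xi1 t t0.
pose T := `|b| + t + `|C| + mdist (gamma1 0) (gamma2 0).
have nb := normr_ge0 b; have nC := normr_ge0 C.
have lb := ler_norm b; have lC := ler_norm C.
have [|N2 hN2] := cu _ xi1 T; first by rewrite /T; lra.
have [N3 hN3] := h2 t t0.
pose n := maxn N1 (maxn N2 N3).
have [_ h1] := hN1 n (leq_maxl _ _).
have [lT _] := hN2 n (leq_trans (leq_maxl N2 N3) (leq_maxr N1 _)).
have {}h2 := hN3 n (leq_trans (leq_maxr N2 N3) (leq_maxr N1 _)).
have [sigma gs] := gX (gamma1 0) (u n).
have [rho gr] := gX (gamma1 0) (v n).
have [tau gt] := gX (gamma2 0) (v n).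
rewrite /T in lT.
have uvn := uv n.
have t1 : mdist (gamma1 0) (u n) <= mdist (gamma1 0) (v n) + mdist (u n) (v n).
  by rewrite (metric_sym (u n)); exact: metric_triangle.
have t2 := metric_triangle (gamma1 0) (gamma2 0) (v n).
have a1 := h1 _ gs; have a4 := h2 _ gt.
have a2 : mdist (sigma t) (rho t) <= K by apply: (hb _ _ _ _ _ gs gr) => //; lra.
have a3 : mdist (rho t) (tau t) <= 5 * mdist (gamma1 0) (gamma2 0) + K.
  by apply: (fellow_common_end gr gt); lra.
have b1 := metric_triangle (gamma1 t) (sigma t) (gamma2 t).
have b2 := metric_triangle (sigma t) (rho t) (gamma2 t).
have b3 := metric_triangle (rho t) (tau t) (gamma2 t).
rewrite (metric_sym (gamma1 t) (sigma t)) in b1; lra.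
Qed.

End Rays.

(** * Conjugation, and stabilizers of boundary points *)

Section Conjugation.
Variable G : topGroupType.
Implicit Types (g x : G).

Let cfwd g x := (g * x * g^-1)%g.
Let cbwd g x := (g^-1 * x * g)%g.

Let cfwdM g : {morph cfwd g : x y / (x * y)%g}.
Proof. by move=> x y; rewrite /cfwd -!mulgA mulKg. Qed.

Let cfwdK g : cancel (cfwd g) (cbwd g).
Proof. by move=> x; rewrite /cfwd /cbwd -!mulgA mulVg mulg1 mulKg. Qed.

Let cbwdK g : cancel (cbwd g) (cfwd g).
Proof. by move=> x; rewrite /cfwd /cbwd -!mulgA mulgV mulg1 mulVKg. Qed.

Let conj_cont g h : continuous (fun x : G => (g * x * h)%g).
Proof.
move=> x; apply: (@continuous_comp _ _ _ (fun x : G => (g * x)%g) (fun x : G => (x * h)%g)).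
  exact: mull_continuous.
exact: mulr_continuous.
Qed.

(** Conjugation by [g], as a topological automorphism. *)
Definition conj_taut g : taut G :=
  Taut (@cfwdM g) (@cfwdK g) (@cbwdK g) (@conj_cont g g^-1%g) (@conj_cont g^-1%g g).

Lemma conj_fwdE g n x : iter n (fwd (conj_taut g)) x = (g ^+ n * x * (g ^+ n)^-1)%g.
Proof.
elim: n => [|n IH]; first by rewrite expg0 invg1 mul1g mulg1.
by rewrite iterS IH /= /cfwd expgS invgM !mulgA.
Qed.

Lemma conj_bwdE g n x : iter n (bwd (conj_taut g)) x = ((g ^+ n)^-1 * x * g ^+ n)%g.
Proof.
elim: n => [|n IH]; first by rewrite expg0 invg1 mul1g mulg1.
by rewrite iterS IH /= /cbwd expgSr invgM !mulgA.
Qed.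

Lemma conj_setE g U : conj_set g U = push (conj_taut g) 1 U.
Proof.
apply/seteqP; split=> [_ [u Uu <-]|x Ux]; first by rewrite /push/= cfwdK.
by exists (cbwd g x) => //; exact: cbwdK.
Qed.

End Conjugation.

Section Action.
Variables (R : realType) (G : topGroupType) (X : metricType R).
Variable a : isom_action G X.
Implicit Types (g h : G) (xi : boundary X) (gamma : R -> X).

Lemma act_ray h gamma : geodesic_ray gamma -> geodesic_ray (a h \o gamma).
Proof. by move=> rg s t s0 t0 /=; rewrite act_isom; exact: rg. Qed.

Lemma act_geodesic h x y sigma : geodesic x y sigma ->
  geodesic (a h x) (a h y) (a h \o sigma).
Proof.
move=> [s0 s1 gs]; rewrite /geodesic act_isom /=; split; rewrite ?s0 ?s1//.
by move=> s t hs ht; rewrite act_isom; exact: gs.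
Qed.

Lemma actK h x : a h^-1%g (a h x) = x.
Proof. by rewrite -actM mulVg act1. Qed.

Lemma actVK h x : a h (a h^-1%g x) = x.
Proof. by rewrite -actM mulgV act1. Qed.

Lemma act_distV h x y : mdist (a h^-1%g x) y = mdist x (a h y).
Proof. by rewrite -(act_isom a h) actVK. Qed.

Lemma act_conj_dist g h n x :
  mdist (a ((g ^+ n)^-1 * h * g ^+ n)%g x) x = mdist (a h (a (g ^+ n)%g x)) (a (g ^+ n)%g x).
Proof. by rewrite -mulgA !actM act_distV. Qed.

Lemma act_cont x : continuous (fun h => a h x).
Proof.
move=> h; apply: (@continuous_comp _ _ _ (fun h : G => (h, x)) (fun p : G * X => a p.1 p.2)).
  by apply: cvg_pair => //; exact: cvg_cst.
exact: act_continuous.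
Qed.

Lemma nbhs_act_close h x : nbhs h [set k | mdist (a h x) (a k x) < 1].
Proof.
have := @act_cont x h (ball (a h x) 1); rewrite ballEmdist; apply.
by rewrite -ballEmdist; exact: nbhsx_ballx.
Qed.

Lemma compact_displacement (A : set G) x : compact A ->
  exists C, forall h, A h -> mdist (a h x) x <= C.
Proof.
move=> cA; pose O := [set k | mdist (a 1%g x) (a k x) < 1]°.
have O1 : O 1%g by exact: nbhs_act_close.
have [s _ cs] := compact_coset_cover cA (@open_interior _ _) O1.
exists (1 + \sum_(y <- s) mdist (a y x) x) => h Ah.
have [y ys /interior_subset/=] := cs h Ah; rewrite act1 => Oy.
apply: le_trans (metric_triangle _ (a y x) _) _; apply: lerD.
  rewrite (_ : mdist _ _ = mdist x (a (y^-1 * h)%g x)); first exact: ltW.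
  by rewrite metric_sym -[RHS](act_isom a y) -actM mulVKg.
rewrite (big_rem y)//= lerDl; apply: sumr_ge0 => z _; exact: mdist_ge0.
Qed.

Lemma stabilizerP xi gamma h : boundary_class xi gamma ->
  subgroup_set (stabilizer a xi) h <-> asymptotic gamma (a h \o gamma).
Proof.
have [rho rrho xiE] := boundaryP xi; rewrite xiE => -[rgamma rg].
split=> [/(congr1 (@boundary_class R X))/= E|hg].
  suff [_ rh] : ray_class rho (a h \o gamma).
    exact: asymptotic_trans (asymptotic_sym rg) rh.
  by rewrite -xiE -E; exists gamma => //; rewrite xiE.
apply: boundary_inj; rewrite /= xiE; apply/seteqP; split=> eta.
  move=> [eta' [reta re] <-]; split; first exact: act_ray.
  apply: (asymptotic_trans rg); apply: (asymptotic_trans hg).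
  have [C hC] := asymptotic_trans (asymptotic_sym rg) re.
  by exists C => t t0 /=; rewrite act_isom; exact: hC.
move=> [reta re]; exists (a h^-1%g \o eta); last first.
  by apply/funext => t /=; rewrite actVK.
split; first exact: act_ray.
apply: (asymptotic_trans rg).
have [C hC] := asymptotic_trans (asymptotic_sym hg) (asymptotic_trans (asymptotic_sym rg) re).
by exists C => t t0 /=; rewrite metric_sym act_distV metric_sym; exact: hC.
Qed.

Variable K : R.
Hypotheses (gX : geodesic_space X) (ftX : fellow_travel X K).

Lemma stabilizer_displacement xi gamma h t : boundary_class xi gamma ->
  subgroup_set (stabilizer a xi) h -> 0 <= t ->
  mdist (a h (gamma t)) (gamma t) <= 5 * mdist (a h (gamma 0)) (gamma 0) + 2 * K.
Proof.
move=> xig /(stabilizerP _ xig) hg t0; have rg := boundary_ray xig.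
have := asymptotic_bound gX ftX rg (act_ray h rg) hg t0.
by rewrite /= (metric_sym (gamma t)) (metric_sym (gamma 0)).
Qed.

Lemma stabilizer_closed xi : closed (subgroup_set (stabilizer a xi)).
Proof.
have [gamma rg xiE] := boundaryP xi.
have xig : boundary_class xi gamma.
  by rewrite xiE; split=> //; exists 0 => t _; rewrite mdistxx.
move=> h clh; apply/(stabilizerP _ xig).
exists (5 * (mdist (a h (gamma 0)) (gamma 0) + 1) + 2 * K + 1) => t t0.
have [k [Hk [k0 kt]]] := clh _ (filterI (nbhs_act_close h (gamma 0)) (nbhs_act_close h (gamma t))).
have := stabilizer_displacement xig Hk t0 => d1.
rewrite /= in k0 kt *.
have d2 := metric_triangle (a k (gamma 0)) (a h (gamma 0)) (gamma 0).
have d3 := metric_triangle (gamma t) (a k (gamma t)) (a h (gamma t)).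
rewrite (metric_sym (a k (gamma 0)) (a h _)) in d2.
rewrite (metric_sym (a k (gamma t)) (a h _)) (metric_sym (gamma t) (a k _)) in d3.
lra.
Qed.

(** If the conjugates [g^-n h g^n] have bounded displacement, the sequences
    [g^n x] and [h g^n x] stay at bounded distance, so [h] fixes their common
    limit. *)
Lemma bounded_conj_stabilizer xi g h x C : coarse_cvg K (fun n => a (g ^+ n)%g x) xi ->
  (forall n, mdist (a ((g ^+ n)^-1 * h * g ^+ n)%g x) x <= C) ->
  subgroup_set (stabilizer a xi) h.
Proof.
move=> cu hC; have [gamma rg xiE] := boundaryP xi.
have xig : boundary_class xi gamma.
  by rewrite xiE; split=> //; exists 0 => t _; rewrite mdistxx.
apply/(stabilizerP _ xig).
apply: (@coarse_cvg_close _ _ _ gX ftX _ (fun n => a h (a (g ^+ n)%g x)) _ _ _ C cu xig).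
  by move=> n; rewrite metric_sym -act_conj_dist.
move=> t t0; have [N hN] := cu _ xig t t0; exists N => n Nn sigma gs.
have [_ h2] := hN n Nn.
have := act_geodesic h^-1%g gs; rewrite /= !actK => /h2 /=.
by rewrite act_distV.
Qed.

Lemma compact_orbit_stabilizer xi g h x (A : set G) :
  coarse_cvg K (fun n => a (g ^+ n)%g x) xi -> compact A ->
  (forall n, A (iter n (bwd (conj_taut g)) h)) ->
  subgroup_set (stabilizer a xi) h.
Proof.
move=> cu cA hA; have [C hC] := compact_displacement x cA.
by apply: (bounded_conj_stabilizer cu (C := C)) => n; apply: hC; rewrite -conj_bwdE.
Qed.

End Action.

(** * Orbits of hyperbolic isometries *)

(** A sequence bounded below by an increasing affine function gains at least [B]
    at some doubling of the index: otherwise [l (2^k)] would grow at most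
    linearly in [k]. *)
Lemma doubling_gain (R : realType) (l : nat -> R) (L C B : R) : 0 < L -> 0 <= B ->
  (forall n, n%:R / L - C <= l n) ->
  exists2 j, (0 < j)%N & l j + B <= l (2 * j)%N.
Proof.
move=> L0 B0 hl; apply: contrapT => nex.
have up k : l (2 ^ k)%N <= l 1%N + k%:R * B.
  elim: k => [|k IH]; first by rewrite mul0r addr0.
  have [h|h] := leP (l (2 ^ k)%N + B) (l (2 * 2 ^ k)%N).
    by case: nex; exists (2 ^ k)%N => //; rewrite expn_gt0.
  by rewrite expnS -natr1 mulrDl mul1r; lra.
pose M := `|l 1%N| + `|C| + 2 * B.
have M0 : 0 <= M by rewrite /M !addr_ge0// mulr_ge0.
pose n := (Num.truncn (L * M)).+1.
have nLM : L * M < n%:R by exact: truncnS_gt.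
have n1 : 1 <= (n%:R : R) by rewrite ler1n.
have h1 := up (2 * n)%N; have h2 := hl (2 ^ (2 * n))%N.
have nn : (n%:R * n%:R : R) <= (2 ^ (2 * n))%:R.
  by rewrite -natrM ler_nat mul2n -addnn expnD leq_mul// ltnW// ltn_expl.
have h3 : M * n%:R < (2 ^ (2 * n))%:R / L.
  rewrite ltr_pdivlMr//; apply: lt_le_trans nn.
  have n0 : 0 < (n%:R : R) by rewrite ltr0n.
  by rewrite mulrAC (ltr_pM2r n0) mulrC.
have h4 : M * n%:R < l 1%N + C + (2 * n)%:R * B by lra.
have l1 := ler_norm (l 1%N); have lC := ler_norm C.
have p1 := normr_ge0 (l 1%N); have p2 := normr_ge0 C.
have h5 : `|l 1%N| <= `|l 1%N| * n%:R by rewrite ler_peMr.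
have h6 : `|C| <= `|C| * n%:R by rewrite ler_peMr.
rewrite natrM in h4; move: h4; rewrite /M !mulrDl => h4; nra.
Qed.

Section Tracking.
Variables (R : realType) (G : topGroupType) (X : metricType R).
Variable a : isom_action G X.
Variable g : G.

Let act_pow m n x : a (g ^+ (m + n))%g x = a (g ^+ m)%g (a (g ^+ n)%g x).
Proof. by rewrite expgnDr actM. Qed.

(** For some point [x] and some [j > 0], the points [g^(ji) x] stay at bounded
    distance from the ray [gamma]. *)
Definition tracks (gamma : R -> X) :=
  exists x D j, (0 < j)%N /\
    forall i, exists2 t, 0 <= t & mdist (a (g ^+ (j * i))%g x) (gamma t) <= D.

Section HyperbolicSpace.
Variables (K delta : R).
Hypotheses (gX : geodesic_space X) (delta0 : 0 <= delta).
Hypothesis thin : thin_triangles X delta.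

Let kappa : R := 2 * (4 * delta + 2).

Section Points.
Variables (x : X) (j : nat).
Let P n := a (g ^+ (j * n))%g x.
Let l n := mdist x (P n).

Let dist_P m n : mdist (P m) (P (m + n)%N) = l n.
Proof. by rewrite /P mulnDr act_pow act_isom. Qed.

Let P0 : P 0%N = x. Proof. by rewrite /P muln0 expg0 act1. Qed.

Let four m n k : l (m + n)%N + l (n + k)%N <= l (m + n + k)%N + l n + kappa \/
  l (m + n)%N + l (n + k)%N <= l m + l k + kappa.
Proof.
have := four_point gX delta0 thin x (P m) (P (m + n)%N) (P (m + n + k)%N).
rewrite -/kappa -(addnA m n k) !dist_P addnA -/(l _) -/(l _) -/(l _) -/(l _).
rewrite (dist_P (m + n)%N k) => -[h|h]; [left|right]; lra.
Qed.

(** If two steps along the orbit of [g^j] are longer than one step by a definite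
    amount, the Gromov products of [x] and [P (m + n)] seen from [P m] are
    bounded: the four-point condition passes from local to global. *)
Lemma orbit_quasi_geodesic : l 1%N + (2 * kappa + 1) <= l 2%N ->
  0 < l 1%N /\ forall m n, l m + l n <= l (m + n)%N + (l 1%N + kappa).
Proof.
have k0 : 0 < kappa by rewrite /kappa; have := delta0; lra.
have l0 : l 0%N = 0 by rewrite /l P0 mdistxx.
have lge n : 0 <= l n by exact: mdist_ge0.
move=> h12.
have step n : l n <= l n.+1 /\ l n.+1 + (kappa + 1) <= l n.+2.
  elim: n => [|n [IH1 IH2]]; first by rewrite l0; split => //; lra.
  split; first lra.
  have := four n.+1 1%N 1%N; rewrite !addn1 => -[h|h]; lra.
split.
  have : l 2%N <= l 1%N + l 1%N.
    have := metric_triangle x (P 1%N) (P 2%N).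
    by rewrite (dist_P 1 1); exact.
  lra.
have l10 := lge 1%N.
move=> [|m] [|n].
- by rewrite addn0 l0; lra.
- by rewrite add0n l0; lra.
- by rewrite addn0 l0; lra.
have [s1 _] := step m; have [_ s2] := step n; have [s3 _] := step n.+1.
have := four m 1%N n.+1; rewrite add1n addn1 => -[h|h]; lra.
Qed.

End Points.

Hypothesis qi : quasi_isometric_orbit a g.

(** The points [g^(jm) x] are close to the geodesics from [x] to the later
    [g^(jn) x], hence to the ray to which these geodesics converge. *)
Lemma hyperbolic_tracks xi gamma : boundary_class xi gamma ->
  (forall x, coarse_cvg K (fun n => a (g ^+ n)%g x) xi) -> tracks gamma.
Proof.
move=> xig cu; have rg := boundary_ray xig.
have [y [L [C [L1 C0 hqi]]]] := qi.
set x := gamma 0.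
have k0 : 0 < kappa by rewrite /kappa; have := delta0; lra.
have [||n|j j0 hj] := @doubling_gain _ (fun n => mdist x (a (g ^+ n)%g x)) L
    (C + 2 * mdist x y) (2 * kappa + 1).
- lra.
- lra.
- have /andP[h _] := hqi n%:Z 0.
  have d1 := metric_triangle (a (g ^+ n)%g y) (a (g ^+ n)%g x) y.
  have d2 := metric_triangle (a (g ^+ n)%g x) x y.
  rewrite act_isom (metric_sym y x) in d1.
  rewrite subr0 /= expg0 act1 in h.
  rewrite (metric_sym (a (g ^+ n)%g x) x) in d2.
  have : (`|n%:Z|%:~R : R) = n%:R by [].
  move=> E; rewrite E mulrC in h; lra.
(* From now on, only the powers of [g^j] are considered. *)
have hl : mdist x (a (g ^+ (j * 1))%g x) + (2 * kappa + 1) <= mdist x (a (g ^+ (j * 2))%g x).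
  by rewrite muln1 [(j * 2)%N]mulnC.
have [l1 qg] := orbit_quasi_geodesic hl.
pose l n := mdist x (a (g ^+ (j * n))%g x).
pose c := l 1%N + kappa.
exists x, (c + (4 * delta + 2) + `|K|), j; split=> // m; exists (l m); first exact: mdist_ge0.
have c0 : 0 < c by rewrite /c; exact: addr_gt0.
have [lm0|lm0] := eqVneq (l m) 0.
  have -> : a (g ^+ (j * m))%g x = x by apply/esym/mdist_positivity.
  rewrite lm0 mdistxx; have := delta0; have := normr_ge0 K; lra.
have lm : 0 < l m by rewrite lt_neqAle eq_sym lm0 mdist_ge0.
have [N hN] := cu x _ xig (l m) lm.
pose n := (N + m)%N.
have [|lmn hs] := hN (j * n)%N.
  by rewrite /n; apply: leq_trans (leq_addr m N) _; rewrite leq_pmull.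
have [sigma gs] := gX x (a (g ^+ (j * n))%g x).
have [tau gt] := gX x (a (g ^+ (j * m))%g x).
have hsK := hs _ gs.
have gp : l m - c / 2 <= gromov_product x (a (g ^+ (j * m))%g x) (a (g ^+ (j * n))%g x).
  have := qg m N; rewrite -/(l m) -/(l N) -/(l _) -/(l 1%N) -/c addnC -/n => h.
  rewrite /gromov_product; have -> : mdist (a (g ^+ (j * m))%g x) (a (g ^+ (j * n))%g x) = l N.
    by rewrite /n addnC mulnDr act_pow act_isom.
  by rewrite -/(l m) -/(l n); lra.
have gp0 : 0 <= gromov_product x (a (g ^+ (j * m))%g x) (a (g ^+ (j * n))%g x).
  rewrite /gromov_product divr_ge0// subr_ge0 (metric_sym x (a (g ^+ (j * m))%g x)).
  exact: metric_triangle.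
(* Up to time [t], the geodesics from [x] to [g^(jm) x] and to [g^(jn) x] stay
   close; and [t] differs from the length [l m] of the first by at most
   [c / 2]. *)
pose t := Num.max 0 (l m - c / 2).
have t0 : 0 <= t by rewrite /t le_max lexx.
have tc : l m - c / 2 <= t by rewrite /t le_max lexx orbT.
have tm : t <= l m by rewrite /t ge_max; apply/andP; split; lra.
have tgp : t <= gromov_product x (a (g ^+ (j * m))%g x) (a (g ^+ (j * n))%g x).
  by rewrite /t ge_max gp0.
have d1 := gromov_product_fellow gX delta0 thin gt gs t0 tgp.
have d2 := geodesic_end gt t0 tm; rewrite -/(l m) in d2.
have d3 := geodesic_dist gs t0 tm (ltW lmn).
have e1 := metric_triangle (a (g ^+ (j * m))%g x) (tau t) (gamma (l m)).
have e2 := metric_triangle (tau t) (sigma t) (gamma (l m)).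
have e3 := metric_triangle (sigma t) (sigma (l m)) (gamma (l m)).
rewrite (metric_sym (a (g ^+ (j * m))%g x) (tau t)) in e1.
have := ler_norm K; rewrite /c in tc *; lra.
Qed.

End HyperbolicSpace.

Lemma axis_tracks K xi gamma : geodesic_space X -> fellow_travel X K ->
  boundary_class xi gamma -> (forall x, coarse_cvg K (fun n => a (g ^+ n)%g x) xi) ->
  has_axis a g -> tracks gamma.
Proof.
move=> gX ftX xig cu [eta heta [k k0 hk]].
have reta : geodesic_ray eta by move=> s t _ _; exact: heta.
have E n : a (g ^+ n)%g (eta 0) = eta (n%:R * k).
  elim: n => [|n IH]; first by rewrite expg0 act1 mul0r.
  by rewrite expgS actM IH hk -natr1 mulrDl mul1r.
have [C hC] : asymptotic gamma eta.
  apply: (@coarse_cvg_close _ _ _ gX ftX _ (fun n => a (g ^+ n)%g (eta 0))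
    _ _ _ 0 (cu (eta 0)) xig).
    by move=> n; rewrite mdistxx.
  move=> t t0; exists (Num.truncn (t / k)).+1 => n Nn sigma gs.
  have tn : t <= n%:R * k.
    rewrite -ler_pdivrMr//; apply: ltW; apply: (lt_le_trans (truncnS_gt _)).
    by rewrite ler_nat.
  have [_ ft _] := ftX; rewrite E in gs.
  have n0 : 0 <= n%:R * k by rewrite mulr_ge0// ltW.
  have ge := ray_geodesic reta n0.
  have dn : mdist (eta 0) (eta (n%:R * k)) = n%:R * k by rewrite (ray_dist reta)// subr0.
  have := ft _ _ _ _ _ t gs ge (ltW t0); rewrite dn mdistxx mulr0 add0r; exact.
exists (eta 0), C, 1%N; split=> // i; exists (i%:R * k); first by rewrite mulr_ge0// ltW.
by rewrite mul1n E metric_sym; apply: hC; rewrite mulr_ge0// ltW.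
Qed.

End Tracking.


(** * Haar measure and the modular function *)

Lemma coset_reps_setI (G : groupType) (A B : set G) s : is_subgroup A ->
  coset_reps A B s <-> coset_reps A (A `&` B) s.
Proof.
move=> sA; split=> -[us As sep cs]; split=> //.
- by move=> y z ys zs [_]; exact: sep.
- move=> x Ax; have [y ys By] := cs x Ax; exists y => //; split=> //.
  by apply: subgroup_div => //; exact: As.
- move=> y z ys zs Byz; apply: sep => //; split=> //.
  by apply: (subgroup_div sA); exact: As.
- by move=> x /cs[y ys [_ By]]; exists y.
Qed.

Section Haar.
Variables (R : realType) (H : topGroupType).
Variable mu : {measure set (borel H) -> \bar R}.
Hypotheses (hH : hausdorff_space H) (haar : right_haar mu).
Implicit Types (A B C U V : set H) (g h : H).

Let open_measurable A : open A -> measurable (A : set (borel H)).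
Proof. by move=> oA; apply: sub_sigma_algebra. Qed.

Lemma left_translateE g A : left_translate g A = (fun x => g^-1 * x)%g @^-1` A.
Proof.
apply/seteqP; split=> [_ [u Au <-]|x Ax]; first by rewrite /= mulKg.
by exists (g^-1 * x)%g => //; rewrite mulVKg.
Qed.

Lemma open_left_translate g A : open A -> open (left_translate g A).
Proof.
by rewrite left_translateE; apply: open_preim; exact: mull_continuous.
Qed.

Let mu_right h A : open A -> mu [set x | A (x * h)%g] = mu A.
Proof.
move=> oA; rewrite -(haar_right_invariant haar (h^-1)%g (open_measurable oA)).
congr (mu _); apply/seteqP; split=> [x Ax|_ [x Ax <-]]; last by rewrite /= mulgVK.
by exists (x * h)%g => //; rewrite mulgK.
Qed.

(** The union of the right translates of [A] by the inverses of the elements of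
    [s]. *)
Let right_union A (s : seq H) : set H := [set x | exists2 y, y \in s & A (x * y)%g].

Let right_union_cons A y s :
  right_union A (y :: s) = [set x | A (x * y)%g] `|` right_union A s.
Proof.
apply/seteqP; split=> x.
  by move=> [z]; rewrite inE => /predU1P[->|zs] Az; [left|right; exists z].
move=> [Ax|[z zs Az]]; first by exists y; rewrite ?inE ?eqxx.
by exists z => //; rewrite inE zs orbT.
Qed.

Let open_right A y : open A -> open [set x | A (x * y)%g].
Proof. exact: open_preim (@mulr_continuous _ y). Qed.

Let open_right_union A s : open A -> open (right_union A s).
Proof.
move=> oA; elim: s => [|y s IH].
  by rewrite (_ : right_union _ _ = set0); [exact: open0|apply/seteqP; split=> // x []].
by rewrite right_union_cons; apply: openU => //; exact: open_right.
Qed.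

(** The measure of a left translate of a subgroup is the sum of the measures of
    the translates of its right cosets, which are equal by right invariance. *)
Lemma mu_translate_index g A C s : is_subgroup A -> is_subgroup C -> open C ->
  C `<=` A -> coset_reps A C s ->
  mu (left_translate g A) = ((size s)%:R%:E * mu (left_translate g C))%E.
Proof.
move=> sA sC oC CA [us As sep cs]; set B := left_translate g C.
have oB : open B by exact: open_left_translate.
have -> : left_translate g A = right_union B s.
  rewrite /B !left_translateE; apply/seteqP; split=> x /=.
    move=> Ax; have [y ys Cy] := cs _ (subgroupV sA Ax); exists y => //.
    by have := subgroupV sC Cy; rewrite invgM !invgK -mulgA.
  move=> [y ys]; rewrite /= mulgA => /CA Axy.
  by have := subgroupM sA Axy (subgroupV sA (As _ ys)); rewrite mulgK.
elim: s us {As cs} sep => [|y s IH] /=.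
  move=> _ _; rewrite mul0e (_ : right_union _ _ = set0) ?measure0//.
  by apply/seteqP; split=> // x [].
move=> /andP[ys us] sep.
have -> : mu (right_union B (y :: s)) = (mu [set x | B (x * y)%g] + mu (right_union B s))%E.
  rewrite right_union_cons; apply: measureU.
  - by apply: open_measurable; exact: open_right.
  - by apply: open_measurable; exact: open_right_union.
  have BE w : B w -> C (g^-1 * w)%g by rewrite /B left_translateE.
  rewrite -subset0 => x [/BE Bxy [z zs /BE Bxz]].
  have : y = z.
    apply: sep; rewrite ?inE ?eqxx ?zs ?orbT//.
    by have := subgroup_div sC Bxy Bxz; rewrite !invgM -!mulgA !mulKg.
  by move=> yz; rewrite yz zs in ys.
rewrite mu_right// IH//; last first.
  by move=> u v us' vs; apply: sep; rewrite inE ?us' ?vs orbT.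
by rewrite -natr1 EFinD ge0_muleDl ?lee_fin// mul1e addeC.
Qed.

(** A null compact open subgroup would make every compact set null, and then
    the whole group, by inner regularity. *)
Lemma haar_gt0 U : compact_open_subgroup U -> (0 < mu U)%E.
Proof.
move=> [sU cU oU]; rewrite lt_neqAle measure_ge0 andbT eq_sym; apply/eqP => U0.
suff : mu setT = 0%E by apply/eqP; exact: (haar_neq0 haar).
rewrite (haar_inner_regular haar)//; last exact: openT.
apply/eqP; rewrite eq_le; apply/andP; split; last first.
  apply: ereal_sup_ubound; exists set0; last by rewrite measure0.
  by split=> //; exact: compact0.
apply: ub_ereal_sup => _ [C [cC _] <-].
have [s _ cs] := compact_coset_cover (compact_image (@invg_continuous H) cC) oU (subgroup1 sU).
have C1 : C `<=` right_union U s.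
  move=> x Cx; have [|y ys Uy] := cs (x^-1)%g; first by exists x.
  by exists y => //; have := subgroupV sU Uy; rewrite invgM !invgK.
have mC : measurable (C : set (borel H)).
  have -> : C = ~` ~` C by rewrite setCK.
  apply: measurableC; apply: open_measurable; apply: closed_openC.
  exact: compact_closed.
apply: (@le_trans _ _ (mu (right_union U s))).
  by apply: le_measure => //; rewrite inE//; apply: open_measurable; exact: open_right_union.
have : mu (right_union U s) = 0%E.
  elim: s {cs C1} => [|y s IH].
    rewrite (_ : right_union _ _ = set0) ?measure0//.
    by apply/seteqP; split=> // x [].
  rewrite right_union_cons measureU0 ?mu_right//.
  - by apply: open_measurable; exact: open_right.
  - by apply: open_measurable; exact: open_right_union.
by move=> ->.
Qed.

Let rmu A : R := fine (mu A).

Let muE U : compact_open_subgroup U -> mu U = (rmu U)%:E.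
Proof.
move=> [_ cU _]; rewrite fineK// ge0_fin_numE ?measure_ge0//.
exact: (haar_compact haar).
Qed.

Let rmu_gt0 U : compact_open_subgroup U -> 0 < rmu U.
Proof. by move=> cosU; have := haar_gt0 cosU; rewrite muE// lte_fin. Qed.

(** A left translate is a right translate of a conjugate. *)
Lemma mu_left_translate g h n U : open U ->
  mu (left_translate (h * g ^+ n)%g U) =
  mu (left_translate h (push (conj_taut g) n U)).
Proof.
move=> oU; rewrite -(@mu_right (g ^+ n)%g (left_translate (h * g ^+ n)%g U)); last first.
  exact: open_left_translate.
congr (mu _); rewrite !left_translateE; apply/funext => x.
by rewrite /push /preimage /= conj_bwdE invgM !mulgA.
Qed.

Lemma push_cos (f : taut H) n U : compact_open_subgroup U ->
  compact_open_subgroup (push f n U).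
Proof.
by move=> [sU cU oU]; split; [exact: push_subgroup|exact: push_compact|exact: push_open].
Qed.

Let cosI U V : compact_open_subgroup U -> compact_open_subgroup V ->
  compact_open_subgroup (U `&` V).
Proof.
move=> [sU cU oU] [sV cV oV]; split; [exact: subgroupI| |exact: openI].
apply: (subclosed_compact _ cU); last by move=> ? [].
by apply: closedI; exact: compact_closed.
Qed.

Lemma fin_coset_reps U V : compact_open_subgroup U -> compact_open_subgroup V ->
  exists s, coset_reps U V s.
Proof.
move=> [sU cU oU] [sV cV oV]; have [n cn] := compact_cov cU oV (subgroup1 sV).
by have [s _ ps] := cov_coset_reps sV cn; exists s.
Qed.

Let left_translate1 U : left_translate 1%g U = U.
Proof. by rewrite left_translateE; apply/funext => x; rewrite /preimage/= invg1 mul1g. Qed.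

Let modular_sub U V g : compact_open_subgroup U -> compact_open_subgroup V ->
  V `<=` U -> modular mu U g = modular mu V g.
Proof.
move=> cosU cosV VU; have [s ps] := fin_coset_reps cosU cosV.
have [sU _ oU] := cosU; have [sV _ oV] := cosV.
have h k := mu_translate_index k sU sV oV VU ps.
have h1 := h 1%g; rewrite !left_translate1 in h1.
have s0 : (size s)%:R != 0 :> R.
  rewrite pnatr_eq0; apply/negP => /eqP s0; have := haar_gt0 cosU.
  by rewrite h1 s0 mul0e ltxx.
rewrite /modular h h1 (muE cosV) /=.
have -> : fine ((size s)%:R%:E * mu (left_translate g V))%E =
    (size s)%:R * fine (mu (left_translate g V)).
  have -> : mu (left_translate g V) = mu (push (conj_taut g) 1 V).
    by have := mu_left_translate g 1%g 1 oV; rewrite mul1g expg1 left_translate1.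
  by rewrite (muE (push_cos (conj_taut g) 1 cosV)).
by rewrite invfM mulrACA divff// mul1r.
Qed.

(** The modular function does not depend on the compact open subgroup. *)
Lemma modular_indep U V g : compact_open_subgroup U -> compact_open_subgroup V ->
  modular mu U g = modular mu V g.
Proof.
move=> cosU cosV; have cosUV := cosI cosU cosV.
rewrite (modular_sub g cosU cosUV); last by move=> ? [].
by rewrite (modular_sub g cosV cosUV)// => ? [].
Qed.

Lemma modularX U g n : compact_open_subgroup U ->
  modular mu U (g ^+ n)%g = modular mu U g ^+ n.
Proof.
move=> cosU; have [sU _ oU] := cosU; elim: n => [|n IH].
  by rewrite expg0 expr0 /modular left_translate1 divff// gt_eqF// rmu_gt0.
have cosn := push_cos (conj_taut g) n cosU.
rewrite exprS -IH -(modular_indep g cosn cosU) /modular expgS mu_left_translate//.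
rewrite [in RHS](_ : mu (left_translate (g ^+ n)%g U) = mu (push (conj_taut g) n U)).
  by rewrite mulrA divfK// gt_eqF// (rmu_gt0 cosn).
by have := mu_left_translate g 1%g n oU; rewrite mul1g left_translate1.
Qed.

(** The modular function as a quotient of indices: [s] counts the cosets in
    [f^n(U)] and [r] those in [U] of their intersection, for [f] the conjugation
    by [g]. *)
Lemma modular_index U g n s r : compact_open_subgroup U ->
  coset_reps (push (conj_taut g) n U) U s -> coset_reps U (push (conj_taut g) n U) r ->
  (0 < size r)%N /\ (size s)%:R = (size r)%:R * modular mu U g ^+ n.
Proof.
move=> cosU; rewrite -modularX//; have cosn := push_cos (conj_taut g) n cosU.
have [sU _ oU] := cosU; have [sn _ on] := cosn.
move=> /(coset_reps_setI _ _ sn) ps /(coset_reps_setI _ _ sU) pr.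
rewrite setIC in ps; have cosC := cosI cosU cosn; have [sC _ oC] := cosC.
have h1 := mu_translate_index 1%g sn sC oC (@subIsetr _ _ _) ps.
have h2 := mu_translate_index 1%g sU sC oC (@subIsetl _ _ _) pr.
rewrite !left_translate1 (muE cosC) in h1 h2.
have c0 := rmu_gt0 cosC.
have r0 : (0 < size r)%N.
  rewrite lt0n; apply/negP => /eqP r0; have := haar_gt0 cosU.
  by rewrite h2 r0 mul0e ltxx.
split=> //; rewrite /modular.
have -> : mu (left_translate (g ^+ n)%g U) = mu (push (conj_taut g) n U).
  by have := mu_left_translate g 1%g n oU; rewrite mul1g left_translate1.
rewrite h1 h2 /= -mulf_div divff ?gt_eqF// mulr1 mulrC divfK//.
by rewrite pnatr_eq0 -lt0n.
Qed.

End Haar.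

(** * The scale function, and closed subgroups *)

Section ScaleFacts.
Variable H : topGroupType.
Implicit Types (U : set H) (g : H).

Lemma scale_valuesP g n : scale_values g n <-> exists2 U, compact_open_subgroup U &
  exists2 s, size s = n & coset_reps (push (conj_taut g) 1 U) U s.
Proof.
split=> -[U cosU hU]; exists U => //; have [sU _ _] := cosU;
  have sP := push_subgroup (conj_taut g) 1 sU; move: hU; rewrite conj_setE.
  move=> /(has_indexP _ _ (subgroupI sU sP))[s sn ps]; exists s => //.
  by apply/(coset_reps_setI _ _ sP); rewrite setIC.
move=> [s sn /(coset_reps_setI _ _ sP)]; rewrite setIC => ps.
by apply/(has_indexP _ _ (subgroupI sU sP)); exists s.
Qed.

Lemma scale_le g U n : compact_open_subgroup U ->
  cov (push (conj_taut g) 1 U) U n -> (scale g <= n)%N.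
Proof.
move=> cosU cn; have [sU _ _] := cosU; have [s sn ps] := cov_coset_reps sU cn.
rewrite /scale; case: xgetP => [m _ [_ mmin]|//].
apply: (leq_trans _ sn); apply: mmin; apply/scale_valuesP.
by exists U => //; exists s.
Qed.

Lemma scale_min g : hausdorff_space H -> (exists U, compact_open_subgroup U) ->
  exists2 U, compact_open_subgroup U &
  exists2 s, size s = scale g & coset_reps (push (conj_taut g) 1 U) U s.
Proof.
move=> hH [U cosU]; apply/scale_valuesP.
have [s ps] := fin_coset_reps (push_cos (conj_taut g) 1 cosU) cosU.
have : exists n, `[< scale_values g n >].
  by exists (size s); apply/asboolP/scale_valuesP; exists U => //; exists s.
move=> /ex_minnP[m /asboolP hm mmin].
rewrite /scale; case: xgetP => [k _ []//|/(_ m)[]].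
by split=> // k hk; apply: mmin; exact/asboolP.
Qed.

End ScaleFacts.

Lemma exp_le_const (F : archiRealFieldType) (x y C : F) (j : nat) : (0 < j)%N -> 0 <= x -> 0 <= y ->
  (forall i, x ^+ (j * i) <= C * y ^+ (j * i)) -> x <= y.
Proof.
move=> j0 x0 y0 h; rewrite leNgt; apply/negP => yx.
have xp : 0 < x by exact: le_lt_trans yx.
have [yE|yn0] := eqVneq y 0.
  by have := h 1%N; rewrite muln1 yE expr0n gtn_eqF// mulr0 leNgt exprn_gt0.
have yp : 0 < y by rewrite lt_neqAle eq_sym yn0.
pose q := x / y; pose e := q - 1.
have e0 : 0 < e by rewrite /e subr_gt0 ltr_pdivlMr// mul1r.
have bern n : 1 + n%:R * e <= q ^+ n.
  elim: n => [|n IH]; first by rewrite mul0r addr0.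
  have qE : q = 1 + e by rewrite /e; ring.
  rewrite exprS; apply: (@le_trans _ _ (q * (1 + n%:R * e))); last first.
    by rewrite ler_wpM2l// qE addr_ge0// ltW.
  rewrite qE -natr1; have n0 : 0 <= n%:R * e ^+ 2 by rewrite mulr_ge0// sqr_ge0.
  by lra.
pose i := (Num.truncn (C / e)).+1.
have iC : C < i%:R * e by rewrite -ltr_pdivrMr//; exact: truncnS_gt.
have := h i; rewrite -ler_pdivrMr ?exprn_gt0// -expr_div_n -/q.
have := bern (j * i)%N; rewrite natrM => b hq.
have : i%:R * e <= j%:R * i%:R * e.
  by rewrite -mulrA ler_peMl ?ler1n// mulr_ge0// ltW.
lra.
Qed.

Section Subgroup.
Variables (G : topGroupType) (S : subgroup G).
Hypotheses (hG : hausdorff_space G) (clS : closed (subgroup_set S)).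
Notation H := (subgroup_type S).
Notation SG := (subgroup_set S).
Implicit Types (A B U V : set H) (g h : H).

Let sS : is_subgroup SG. Proof. exact: subgroupP. Qed.

Let v : H -> G := fun x => val x.

Let v_cont : continuous v. Proof. exact: subgroup_val_continuous. Qed.
Let v_inj : injective v. Proof. exact: val_inj. Qed.

Let valP' (x : H) : SG (v x).
Proof. by have := valP x; rewrite inE. Qed.

Let val_ex (x : G) : SG x -> exists y : H, v y = x.
Proof. by move=> Sx; exists (SigSub (mem_set Sx)). Qed.

Let valM' (x y : H) : v (x * y)%g = (v x * v y)%g. Proof. exact: valM. Qed.
Let valV' (x : H) : v (x^-1)%g = ((v x)^-1)%g. Proof. exact: gmulfV. Qed.
Let valX' (x : H) n : v (x ^+ n)%g = ((v x) ^+ n)%g. Proof. exact: gmulfXn. Qed.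
Let val1' : v (1%g : H) = 1%g. Proof. exact: gmulf1. Qed.

Lemma subgroup_open_preim U : open U -> exists2 O : set G, open O & U = v @^-1` O.
Proof. by move=> [D oD <-]; exists D. Qed.

Lemma subgroup_hausdorff : hausdorff_space H.
Proof.
move=> x y cxy; apply: v_inj; apply: hG => A B nA nB.
have [z [Az Bz]] := cxy _ _ (@v_cont x A nA) (@v_cont y B nB).
by exists (v z).
Qed.

(** Closedness of the subgroup is what makes the trace of a compact set
    compact. *)
Lemma subgroup_compact (A : set G) : compact A -> compact (v @^-1` A).
Proof.
move=> cA F FF FA.
have cAS : compact (A `&` SG) by exact: compact_closedI.
have FF' : ProperFilter (v @ F) by exact: fmap_proper_filter.
have [|p [[Ap Sp] clp]] := cAS _ FF'.
  rewrite /= nbhs_simpl/=; apply: filterS FA => x Ax; split=> //; exact: valP'.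
have [y yp] := val_ex Sp; exists y; split; first by rewrite /= yp.
move=> E N FE; rewrite nbhsE => - [W [[D oD DW] Wy] WN].
have nD : nbhs p D.
  apply: open_nbhs_nbhs; split=> //; rewrite -yp.
  by have : (v @^-1` D) y by rewrite DW.
have FE' : (v @ F) (v @` E).
  by rewrite /= nbhs_simpl/=; apply: filterS FE => z Ez; exists z.
have [q [[z Ez zq] Dq]] := clp _ _ FE' nD.
exists z; split=> //; apply: WN; suff : (v @^-1` D) z by rewrite DW.
by change (D (v z)); rewrite zq.
Qed.

Lemma subgroup_cos (U : set G) : compact_open_subgroup U ->
  compact_open_subgroup (v @^-1` U).
Proof.
move=> [sU cU oU]; split; last first.
- exact: open_preim v_cont oU.
- exact: subgroup_compact.
split; rewrite /preimage/=.
- by rewrite val1'; exact: subgroup1.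
- by move=> x y ? ?; rewrite valM'; exact: subgroupM.
- by move=> x ?; rewrite valV'; exact: subgroupV.
Qed.

(** The image in the ambient group. *)
Let im A : set G := v @` A.

Lemma im_subgroup U : is_subgroup U -> is_subgroup (im U).
Proof.
move=> sU; split.
- by exists 1%g; [exact: subgroup1|exact: val1'].
- by move=> _ _ [x Ux <-] [y Uy <-]; exists (x * y)%g; [exact: subgroupM|exact: valM'].
- by move=> _ [x Ux <-]; exists (x^-1)%g; [exact: subgroupV|exact: valV'].
Qed.

Let imE U x : im U (v x) <-> U x.
Proof. by split=> [[y Uy /v_inj <-//]|Ux]; exists x. Qed.

Lemma im_push h n U : im (push (conj_taut h) n U) = push (conj_taut (v h)) n (im U).
Proof.
apply/seteqP; split=> [_ [x Ux <-]|x].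
  rewrite /push/= conj_bwdE -valX' -valV' -!valM'; apply/imE.
  by rewrite -conj_bwdE.
rewrite /push/= conj_bwdE => -[y Uy yE].
exists (iter n (fwd (conj_taut h)) y); last first.
  rewrite conj_fwdE !valM' valV' !valX' yE -!mulgA mulgV mulg1 mulVKg//.
change (U (iter n (bwd (conj_taut h)) (iter n (fwd (conj_taut h)) y))).
by rewrite fiterK.
Qed.

Lemma im_cov A B n : cov A B n -> cov (im A) (im B) n.
Proof.
move=> [s sn cs]; exists (map v s); first by rewrite size_map.
move=> _ [x Ax <-]; have [y ys By] := cs x Ax; exists (v y); first exact: map_f.
by exists (y^-1 * x)%g => //; rewrite valM' valV'.
Qed.

Lemma im_covV A B n : is_subgroup B -> cov (im A) (im B) n -> cov A B n.
Proof.
move=> sB /(cov_coset_reps (im_subgroup sB))[s sn [_ As _ cs]].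
exists (pmap (fun y => insub y) s : seq H).
  by rewrite (leq_trans _ sn)// size_pmap; exact: count_size.
move=> x Ax; have [|y ys By] := cs (v x); first by exists x.
have [z Az zy] := As _ ys; exists z.
  by rewrite mem_pmap; apply/mapP; exists y => //; rewrite -zy valK.
by apply/imE; rewrite valM' valV' zy.
Qed.

Lemma im_compact U : compact U -> compact (im U).
Proof. by move=> cU; apply: compact_image cU; exact: v_cont. Qed.

(** The scale does not increase when passing to a closed subgroup. *)
Lemma scale_closed_subgroup h : (exists U : set G, compact_open_subgroup U) ->
  (scale h <= scale (v h))%N.
Proof.
move=> exU; have [U cosU [s <- [_ _ _ cs]]] := scale_min (v h) hG exU.
pose V := v @^-1` U.
have cosV : compact_open_subgroup V by exact: subgroup_cos.
have [sU _ _] := cosU.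
apply: (scale_le cosV).
suff [r rs [ur Vr sep cr]] : exists2 r, (size r <= size s)%N &
    coset_reps (push (conj_taut h) 1 V) V r by exists r.
have [r pr] := fin_coset_reps (push_cos (conj_taut h) 1 cosV) cosV.
exists r => //; have [ur Ar sepr cr] := pr.
have pr' : coset_reps (im (push (conj_taut h) 1 V)) U (map v r).
  split.
  - by rewrite map_inj_uniq//; exact: v_inj.
  - by move=> _ /mapP[y yr ->]; exists y => //; exact: Ar.
  - move=> _ _ /mapP[y yr ->] /mapP[z zr ->]; rewrite -valV' -valM' => Uyz.
    by rewrite (sepr y z).
  - move=> _ [x Ax <-]; have [y yr Vy] := cr x Ax; exists (v y); first exact: map_f.
    by rewrite -valV' -valM'.
rewrite -(size_map v r); apply: (coset_reps_le_cover sU pr') => x [y hy <-].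
apply: cs; change (U (iter 1 (bwd (conj_taut (v h))) (v y))).
have : U (v (iter 1 (bwd (conj_taut h)) y)) by [].
by rewrite !conj_bwdE !valM' valV' valX'.
Qed.

Variable h : H.
Hypothesis exU : exists U : set G, compact_open_subgroup U.

(** The subgroup contains the elements whose backward orbit under conjugation
    by [h] stays in a compact open subgroup of the ambient group. *)
Hypothesis contains_plus : forall (U : set G) x, compact_open_subgroup U ->
  uplus (conj_taut (val h)) U x -> SG x.

Let growth : exists2 t, (scale (val h) <= t)%N & forall V, compact_open_subgroup V ->
  exists C, forall n a, cov (push (conj_taut h) n V) V a -> (t ^ n <= C * a)%N.
Proof.
have [Y cosY] := exU.
have [x|t [[W cosW covW] ht]] := scale_growth hG cosY sS clS _ contains_plus.
  move=> Sx; apply: (subgroupM sS); last by apply: (subgroupV sS); exact: valP'.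
  by apply: (subgroupM sS) => //; exact: valP'.
exists t; first exact: scale_le cosW covW.
move=> V [sV cV oV]; have [D oD VD] := subgroup_open_preim oV.
have [|x [Sx Dx]|C hC] := ht (im V) D (im_subgroup sV) (im_compact cV) oD.
- by have : V 1%g := subgroup1 sV; rewrite VD /preimage /= -val1'.
- by have [y yx] := val_ex Sx; exists y => //; rewrite VD; rewrite -yx in Dx.
exists C => n a cova; apply: hC; rewrite -im_push; exact: im_cov.
Qed.

Lemma scale_subgroup : scale (val h) = scale h.
Proof.
have [t st ht] := growth; apply/eqP; rewrite eqn_leq scale_closed_subgroup// andbT.
apply: leq_trans st _.
have exV : exists V : set H, compact_open_subgroup V.
  by have [U cosU] := exU; exists (v @^-1` U); exact: subgroup_cos.
have [V cosV [s sh ps]] := scale_min h subgroup_hausdorff exV.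
have [C hC] := ht V cosV.
rewrite -(ler_nat rat); apply: (@exp_le_const _ _ _ C%:R 1) => // i.
rewrite mul1n -!natrX -natrM ler_nat; apply: hC.
by rewrite -sh; apply: cov_iter; exact: coset_reps_cov.
Qed.

Let recurrent_index (Kc : set G) j U : compact Kc -> compact_open_subgroup U ->
  (forall i k, U k -> Kc (iter (j * i) (bwd (conj_taut (val h))) (val k))) ->
  exists c, forall i, cov U (push (conj_taut h) (j * i) U) c.
Proof.
move=> cK [sU cU oU] hK; have [D oD UD] := subgroup_open_preim oU.
have [|s As cs] := @compact_coset_cover _ (Kc `&` SG) D (compact_closedI cK clS) oD.
  by have : U 1%g := subgroup1 sU; rewrite UD /preimage /= -val1'.
have covK : cov (Kc `&` SG) (im U) (size s).
  exists s => // x [Kx Sx]; have [y ys Dy] := cs x (conj Kx Sx); exists y => //.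
  have [z zE] : exists z, v z = (y^-1 * x)%g.
    by apply: val_ex; apply: (subgroup_div sS) => //; case: (As _ ys).
  by exists z => //; rewrite UD; rewrite -zE in Dy.
exists (size s) => i; apply: im_covV; first exact: push_subgroup.
rewrite im_push; apply: cov_sub (push_cov (conj_taut (v h)) (j * i) covK) => //.
move=> _ [k Uk <-]; split; first exact: hK.
rewrite conj_bwdE -valX' -valV' -!valM'; exact: valP'.
Qed.

(** If the backward orbits of a compact open subgroup under some power of the
    conjugation stay in a compact set, the indices measuring the contraction
    are bounded along that power, so that the growth rate of the indices
    measuring the expansion is the modular function. *)
Lemma scale_modular (R : realType) (mu : {measure set (borel H) -> \bar R})
    (Kc : set G) j U : right_haar mu -> compact_open_subgroup U ->
  compact Kc -> (0 < j)%N ->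
  (forall i k, U k -> Kc (iter (j * i) (bwd (conj_taut (val h))) (val k))) ->
  (scale (val h))%:R = modular mu U h.
Proof.
move=> haar cosU cK j0 hK; have hH := subgroup_hausdorff.
have [c hc] := recurrent_index cK cosU hK.
have [t st ht] := growth; have [C hC] := ht U cosU.
have [sU cU oU] := cosU.
have D0 : 0 <= modular mu U h by rewrite /modular divr_ge0// fine_ge0// measure_ge0.
apply/eqP; rewrite eq_le; apply/andP; split.
  apply: (@exp_le_const _ _ _ (C%:R * c%:R) j) => // i.
  have [r rc pr] := cov_coset_reps (push_subgroup (conj_taut h) (j * i) sU) (hc i).
  have [s ps] := fin_coset_reps (push_cos (conj_taut h) (j * i) cosU) cosU.
  have [r0 sE] := modular_index hH haar cosU ps pr.
  apply: (@le_trans _ _ (C * size s)%:R).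
    rewrite -natrX ler_nat; apply: leq_trans (hC _ _ (coset_reps_cov ps)).
    by elim: (j * i)%N => // n IH; rewrite !expnS leq_mul.
  rewrite natrM sE -mulrA ler_wpM2l// ler_wpM2r ?exprn_ge0// ler_nat.
  exact: rc.
rewrite scale_subgroup.
have [V cosV [s sh ps]] := scale_min h hH (ex_intro _ U cosU).
have [r pr] := fin_coset_reps cosV (push_cos (conj_taut h) 1 cosV).
have [r0 sE] := modular_index hH haar cosV ps pr.
rewrite (modular_indep hH haar h cosU cosV) -sh sE expr1.
rewrite ler_peMl ?ler1n//.
by rewrite -(modular_indep hH haar h cosU cosV).
Qed.

End Subgroup.

(** * The stabilizer of an attracting point *)

Theorem corollary1p2 (R : realType) (c : npc_case) (X : metricType R)
    (hX : npc_space c X) (G : topGroupType) (hG : tdlc G)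
    (a : isom_action G X) (g : G) (hg : ~ bounded_action a g)
    (xi : boundary X) (hxi : attracting a c g xi) :
  exists2 h : subgroup_type (stabilizer a xi), val h = g &
    scale g = scale h /\
    (proper_action a -> hyperbolic a c g ->
     forall mu : {measure set (borel (subgroup_type (stabilizer a xi))) -> \bar R},
       right_haar mu ->
     forall U : set (subgroup_type (stabilizer a xi)),
       compact_open_subgroup U ->
       (scale g)%:R = modular mu U h).
Proof.
have [K ftX hcoarse] := npc_coarse hX; have [gX _] := hX.
have cu x : coarse_cvg K (fun n => a (g ^+ n)%g x) xi by exact/hcoarse/hxi.
have [gamma rg xiE] := boundaryP xi.
have xig : boundary_class xi gamma.
  by rewrite xiE; split=> //; exists 0 => t _; rewrite mdistxx.
have Sg : subgroup_set (stabilizer a xi) g.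
  apply: (bounded_conj_stabilizer gX ftX
    (C := mdist (a g (gamma 0)) (gamma 0)) (cu (gamma 0))) => n.
  by rewrite -mulgA -expgS expgSr mulKg.
have clS := stabilizer_closed (a := a) gX ftX (xi := xi).
have [haG _ _] := hG; have exU := exists_compact_open_subgroup hG.
pose h : subgroup_type (stabilizer a xi) := SigSub (mem_set Sg).
have hplus U x : compact_open_subgroup U -> uplus (conj_taut (val h)) U x ->
    subgroup_set (stabilizer a xi) x.
  move=> [_ cU _] Ux.
  exact: (compact_orbit_stabilizer gX ftX (cu (gamma 0)) cU Ux).
exists h => //; split; first exact: (scale_subgroup haG clS exU hplus).
move=> propa hypg mu haar U cosU.
have [x [D [j [j0 hD]]]] : tracks a g gamma.
  case: c hX hypg {hxi hcoarse} => -[_ [_ thinX]] hypg.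
    exact: (axis_tracks gX ftX xig cu hypg).
  have [delta d0 thin] := thinX.
  exact: (hyperbolic_tracks gX d0 thin hypg xig cu).
have [B hB] : exists B, forall k, U k -> mdist (a (val k) (gamma 0)) (gamma 0) <= B.
  have [_ cU _] := cosU.
  have [B hB] := compact_displacement a (gamma 0)
    (compact_image (@subgroup_val_continuous _ (stabilizer a xi)) cU).
  by exists B => k Uk; apply: hB; exists k.
(* The displacement of [x] by all [g^(-ji) k g^(ji)] is at most [M]. *)
pose M := `|D + (5 * B + 2 * K) + D| + 1.
have M0 : 0 < M by rewrite /M ltr_wpDl.
apply: (scale_modular haG clS exU hplus haar cosU (propa x M M0) j0) => i k Uk.
apply: subset_closure; rewrite /= conj_bwdE act_conj_dist -/(val h).
have [t t0 tD] := hD i.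
have d1 : mdist (a (val k) (gamma t)) (gamma t) <= 5 * B + 2 * K.
  have Sk : subgroup_set (stabilizer a xi) (val k) by have := valP k; rewrite inE.
  have := stabilizer_displacement gX ftX xig Sk t0; have := hB k Uk; lra.
have d2 := metric_triangle (a (val k) (a (g ^+ (j * i))%g x)) (a (val k) (gamma t))
  (a (g ^+ (j * i))%g x).
have d3 := metric_triangle (a (val k) (gamma t)) (gamma t) (a (g ^+ (j * i))%g x).
rewrite act_isom in d2; rewrite (metric_sym (gamma t)) in d3.
have := ler_norm (D + (5 * B + 2 * K) + D); rewrite /M /= => nM.
by lra.
Qed.
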